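(* The surjection operad $\mathcal{X}$ is a quotient of the Barratt-Eccles operad $\mathcal{E}$. More precisely, the table reduction morphism $TR:\mathcal{E}\to\mathcal{X}$ is a surjective morphism of filtered dg-operads (that is, a surjective morphism of dg-operads with $TR(F_n\mathcal{E})\subseteq F_n\mathcal{X}$ for all $n\ge1$) such that $F_1TR:F_1\mathcal{E}\to F_1\mathcal{X}$ is the identity isomorphism of the associative operad.
   Context: $\mathbb{F}$ is a fixed commutative ground ring; operads are in dg-modules over $\mathbb{F}$, and the formulas below concern arities $r,s\ge1$. The associative operad has $\mathbb{F}[\Sigma_r]$ in arity $r$; it is identified with $F_1\mathcal{E}$ (generated by the $0$-simplices $(w_0)$) and with $F_1\mathcal{X}$ (generated by the bijections). Barratt-Eccles operad: $\mathcal{E}(r)_d$ is the $\mathbb{F}$-module generated by $(d+1)$-tuples $(w_0,\ldots,w_d)$ of elements of $\Sigma_r$, modulo the tuples with $w_i=w_{i+1}$ for some $i$; $\delta(w_0,\ldots,w_d)=\sum_{i}(-1)^i(w_0,\ldots,\widehat{w_i},\ldots,w_d)$; diagonal $\Sigma_r$-action. A permutation is written as its sequence of values. For $u\in\Sigma_r$, $v\in\Sigma_s$, $u\circ_k v\in\Sigma_{r+s-1}$ is obtained from $(u(1),\ldots,u(r))$ by replacing the entry $k$ by $(v(1)+k-1,\ldots,v(s)+k-1)$ and increasing by $s-1$ the entries $u(i)>k$. For $u\in\mathcal{E}(r)_d$, $v\in\mathcal{E}(s)_e$, $u\circ_k v=\sum\pm(u_{x_0}\circ_k v_{y_0},\ldots,u_{x_{d+e}}\circ_k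 v_{y_{d+e}})$ over lattice paths $(x_c,y_c)$ from $(0,0)$ to $(d,e)$ with unit steps increasing $x$ or $y$; the sign is the signature of the shuffle moving all $x$-steps before all $y$-steps. Surjection operad: $\mathcal{X}(r)_d$ is the $\mathbb{F}$-module generated by maps $u:\{1,\ldots,r+d\}\to\{1,\ldots,r\}$, written as sequences $(u(1),\ldots,u(r+d))$, where non-surjective maps and degenerate ones ($u(i)=u(i+1)$ for some $i$) are set to zero. $\Sigma_r$ acts by $\sigma\cdot u=(\sigma(u(1)),\ldots,\sigma(u(r+d)))$. The caesuras of $u$ are the $d$ elements $u(i)$ that are not the last occurrence of their value. The table arrangement of $u$ splits the sequence into $d+1$ consecutive lines, indexed $0,\ldots,d$, each line except the last ending with a caesura. Differential: $\delta(u)=\sum_i\pm(u(1),\ldots,\widehat{u(i)},\ldots,u(r+d))$; the caesuras get alternating signs $+,-,+,\ldots$ in order; the last occurrence of a value that occurs at least twice gets the sign opposite to that of the previous occurrence of this value; omission of a value that occurs only once gives $0$. Composition: for $u\in\mathcal{X}(r)_d$, $v\in\mathcal{X}(s)_e$, let $u(i_1),\ldots,u(i_n)$ be the occurrences of $k$ in $u$, and put $i_0=1$, $i_{n+1}=r+d$. For each choice $1=j_0\le j_1\le\cdots\le j_n=s+e$, form a composite surjection by replacing $u(i_m)$ by $(v(j_{m-1}),\ldots,v(j_m))$ for $m=1,\ldots,n$, increasing the terms of $v$ by $k-1$ and the terms $u(i)>k$ by $s-1$. Then $u\circ_k v$ is the signed sum of all these composite surjections. The sign is the Koszul sign of the permutation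 from $U_1\cdots U_{n+1}V_1\cdots V_n$ to $U_1V_1U_2V_2\cdots V_nU_{n+1}$, where $U_m=(u(i_{m-1}),\ldots,u(i_m))$ and $V_m=(v(j_{m-1}),\ldots,v(j_m))$ have as degree the number of lines of the table arrangement of $u$ (resp. $v$) that they meet, minus $1$. Table reduction: $TR(w_0,\ldots,w_d)=\sum_{(r_0,\ldots,r_d)}w'$, over all $r_0,\ldots,r_d\ge1$ with $r_0+\cdots+r_d=r+d$ (all signs positive), where $w'$ is the concatenation of lines of lengths $r_0,\ldots,r_d$, line $i$ consisting of the first $r_i$ terms of $(w_i(1),\ldots,w_i(r))$ which do not occur among the non-final entries of the preceding lines $0,\ldots,i-1$ (the last entry of each preceding line is disregarded). Filtrations: $F_n\mathcal{E}(r)$ is spanned by the tuples $(w_0,\ldots,w_d)$ such that, for all $i<j$, the relative order of $i$ and $j$ in the sequences $w_0,\ldots,w_d$ changes at most $n-1$ times. $F_n\mathcal{X}(r)$ is spanned by the surjections $u$ such that, for all $i<j$, the subsequence of $u$ formed by the occurrences of $i$ and $j$ has at most $n$ variations (places where consecutive terms differ). *)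

(* Defs.v *)
From HB Require Import structures.
From mathcomp Require Import all_boot all_order all_algebra all_fingroup.

Set Implicit Arguments.
Unset Strict Implicit.
Unset Printing Implicit Defensive.

Import GRing.Theory.
Local Open Scope ring_scope.

(* Throughout, sets {1, ..., r} are replaced by 'I_r = {0, ..., r-1}, and all
   positions in sequences are counted from 0.  Operads are considered in
   arities >= 1, which are written r.+1; the partial composite of arities r.+1
   and s.+1 has arity (r + s).+1. *)

(* The free R-module on a finite type T; [lin_ext] and [bilin_ext] are the
   (bi)linear extensions of maps given on the basis. *)
Notation freemod R T := {ffun T -> R^o}.

Section FreeModule.
Variable R : comPzRingType.

Definition lin_ext (T : finType) (M : lmodType R) (g : T -> M)
    (x : freemod R T) : M :=
  \sum_(t : T) (x t : R) *: g t.

Definition bilin_ext (S T : finType) (M : lmodType R) (g : S -> T -> M)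
    (x : freemod R S) (y : freemod R T) : M :=
  \sum_(s : S) \sum_(t : T) ((x s : R) * (y t : R)) *: g s t.

Definition in_span (T : finType) (M : lmodType R) (P : pred T) (g : T -> M)
    (x : M) : Prop :=
  exists c : T -> R, x = \sum_(t | P t) c t *: g t.

End FreeModule.

(* The carrier in arity r and degree d is [dgo_car _ r d]; degrees are
   nonnegative, so the differential vanishes on degree 0 and is only recorded
   on positive degrees.  The record only gathers the structure maps which a
   morphism of dg-operads has to preserve. *)
Record dg_operad_data (R : comPzRingType) := DgOperadData {
  dgo_car : nat -> nat -> lmodType R;
  dgo_diff : forall r d, dgo_car r.+1 d.+1 -> dgo_car r.+1 d;
  dgo_act : forall r d, 'S_r.+1 -> dgo_car r.+1 d -> dgo_car r.+1 d;
  dgo_unit : dgo_car 1 0;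
  dgo_comp : forall r s d e, dgo_car r.+1 d -> 'I_r.+1 -> dgo_car s.+1 e ->
    dgo_car (r + s).+1 (d + e)
}.

(* The maps have degree 0, hence no Koszul sign occurs. *)
Record dg_operad_morphism (R : comPzRingType) (O P : dg_operad_data R)
    (f : forall r d, dgo_car O r d -> dgo_car P r d) : Prop := {
  morph_linear : forall r d, linear (f r.+1 d);
  morph_diff : forall r d (x : dgo_car O r.+1 d.+1),
    f r.+1 d (dgo_diff x) = dgo_diff (f r.+1 d.+1 x);
  morph_act : forall r d (s : 'S_r.+1) (x : dgo_car O r.+1 d),
    f r.+1 d (dgo_act s x) = dgo_act s (f r.+1 d x);
  morph_unit : f 1 0 (dgo_unit O) = dgo_unit P;
  morph_comp : forall r s d e (x : dgo_car O r.+1 d) (k : 'I_r.+1)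
      (y : dgo_car O s.+1 e),
    f (r + s).+1 (d + e) (dgo_comp x k y) =
      dgo_comp (f r.+1 d x) k (f s.+1 e y)
}.

Definition delete_at (T : Type) (i : nat) (s : seq T) : seq T :=
  take i s ++ drop i.+1 s.

(* The segment (s_a, ..., s_b), both ends included. *)
Definition segment (T : Type) (a b : nat) (s : seq T) : seq T :=
  take (b - a).+1 (drop a s).

Fixpoint nondegenerate (T : eqType) (s : seq T) : bool :=
  if s is x :: s' then
    (if s' is y :: _ then x != y else true) && nondegenerate s'
  else true.

Definition variations (T : eqType) (s : seq T) : nat :=
  count (fun p => p.1 != p.2) (zip s (behead s)).

Definition pseq (r : nat) (w : 'S_r) : seq 'I_r := [seq w i | i <- enum 'I_r].

(* Renumbering of values in a substitution of the entry k: values y of the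
   inserted sequence, and values x != k of the ambient sequence. *)
Definition shift_in (r s : nat) (k : 'I_r.+1) (y : 'I_s.+1) : 'I_(r + s).+1 :=
  inord (k + y).

Definition shift_out (r s : nat) (k x : 'I_r.+1) : 'I_(r + s).+1 :=
  inord (if (k < x)%N then (x + s)%N else x).

Definition pcomp_seq (r s : nat) (u : 'S_r.+1) (k : 'I_r.+1) (v : 'S_s.+1) :
    seq 'I_(r + s).+1 :=
  flatten [seq if x == k then [seq shift_in k y | y <- pseq v]
               else [:: shift_out s k x] | x <- pseq u].

Lemma size_pseq r (w : 'S_r) : size (pseq w) = r.
Proof. by rewrite size_map size_enum_ord. Qed.

Lemma pseq_uniq r (w : 'S_r) : uniq (pseq w).
Proof. by rewrite map_inj_uniq ?enum_uniq //; apply: perm_inj. Qed.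

Lemma mem_pseq r (w : 'S_r) x : x \in pseq w.
Proof. by apply/mapP; exists ((w^-1)%g x); rewrite ?mem_enum ?permKV. Qed.

Lemma shift_inE r s (k : 'I_r.+1) (y : 'I_s.+1) :
  shift_in k y = (k + y)%N :> nat.
Proof. by rewrite inordK // ltnS leq_add // -ltnS. Qed.

Lemma shift_outE r s (k x : 'I_r.+1) :
  shift_out s k x = (if k < x then x + s else x)%N :> nat.
Proof.
have xr : (x <= r)%N by rewrite -ltnS.
by rewrite inordK // ltnS; case: ifP => _; rewrite ?leq_add2r ?(leq_trans xr) ?leq_addr.
Qed.

Lemma shift_in_inj r s (k : 'I_r.+1) : injective (@shift_in r s k).
Proof.
move=> x y /(congr1 (@nat_of_ord _)); rewrite !shift_inE => /addnI xy.
exact: val_inj.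
Qed.

Lemma mem_pcomp_seq r s (u : 'S_r.+1) k (v : 'S_s.+1) z :
  z \in pcomp_seq u k v.
Proof.
apply/flatten_mapP; have zr := ltn_ord z.
case: (ltnP z k) => [zk | kz].
  have zlt : (z < r.+1)%N := ltn_trans zk (ltn_ord k).
  exists (Ordinal zlt); rewrite ?mem_pseq // ifF; last first.
    by apply/eqP => /(congr1 (@nat_of_ord _)) /= zEk; rewrite zEk ltnn in zk.
  rewrite inE; apply/eqP/val_inj; rewrite /= shift_outE /=.
  by rewrite ltnNge (ltnW zk).
case: (leqP z (k + s)) => [zks | kszl].
  exists k; rewrite ?mem_pseq // eqxx.
  have ylt : (z - k < s.+1)%N by rewrite ltnS leq_subLR.
  apply/mapP; exists (Ordinal ylt); rewrite ?mem_pseq //.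
  by apply: val_inj; rewrite /= shift_inE /= subnKC.
have sz : (s <= z)%N by exact: leq_trans (leq_addl k s) (ltnW kszl).
have zlt : (z - s < r.+1)%N by rewrite ltnS leq_subLR (addnC s); exact: zr.
have kz' : (k < z - s)%N by rewrite ltn_subRL addnC.
exists (Ordinal zlt); rewrite ?mem_pseq // ifF; last first.
  by apply/eqP => /(congr1 (@nat_of_ord _)) /= zEk; rewrite zEk ltnn in kz'.
rewrite inE; apply/eqP/val_inj; rewrite /= shift_outE /= kz'.
by rewrite subnK.
Qed.

Lemma size_pcomp_seq r s (u : 'S_r.+1) k (v : 'S_s.+1) :
  size (pcomp_seq u k v) = (r + s).+1.
Proof.
rewrite /pcomp_seq size_flatten /shape -map_comp sumnE big_map.
have pE : perm_eq (pseq u) (enum 'I_r.+1).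
  apply: uniq_perm; rewrite ?pseq_uniq ?enum_uniq // => x.
  by rewrite mem_pseq mem_enum.
rewrite (perm_big _ pE) /=.
rewrite big_enum (bigD1 k) //= eqxx size_map size_pseq.
rewrite (eq_bigr (fun=> 1%N)) => [|i /negbTE -> //].
by rewrite sum1_card cardC1 card_ord addSn addnC.
Qed.

Lemma pcomp_seq_uniq r s (u : 'S_r.+1) k (v : 'S_s.+1) :
  uniq (pcomp_seq u k v).
Proof.
apply: (@leq_size_uniq _ (enum 'I_(r + s).+1)); first exact: enum_uniq.
  by move=> z _; apply: mem_pcomp_seq.
by rewrite size_pcomp_seq size_enum_ord.
Qed.

Lemma pcomp_inj r s (u : 'S_r.+1) k (v : 'S_s.+1) :
  injective (fun i : 'I_(r + s).+1 => nth ord0 (pcomp_seq u k v) i).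
Proof.
move=> i j /eqP; rewrite nth_uniq ?size_pcomp_seq ?pcomp_seq_uniq //.
by move=> /eqP /val_inj.
Qed.

(* The partial composite of permutations: the permutation whose sequence of
   values is [pcomp_seq u k v] (see [pseq_pcomp]). *)
Definition pcomp (r s : nat) (u : 'S_r.+1) (k : 'I_r.+1) (v : 'S_s.+1) :
    'S_(r + s).+1 :=
  perm (@pcomp_inj r s u k v).

Lemma pseq_pcomp r s (u : 'S_r.+1) k (v : 'S_s.+1) :
  pseq (pcomp u k v) = pcomp_seq u k v.
Proof.
apply: (@eq_from_nth _ ord0) => [|i]; rewrite size_pseq ?size_pcomp_seq // => ilt.
rewrite (nth_map ord0) ?size_enum_ord // permE.
by rewrite nth_enum_ord.
Qed.

Section Operads.
Variable R : comPzRingType.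

(* The free module R[S_r], concentrated in degree 0. *)
Definition assoc_basis (r d : nat) := {w : 'S_r | d == 0%N}.
Definition Assoc (r d : nat) : lmodType R := freemod R (assoc_basis r d).

(* The class of a permutation (zero if d > 0). *)
Definition agen (r d : nat) (w : 'S_r) : Assoc r d :=
  [ffun t => (val t == w)%:R].

(* [(w * s)%g i = s (w i)], so this is the action by left translation. *)
Definition assoc_act (r d : nat) (s : 'S_r.+1) : Assoc r.+1 d -> Assoc r.+1 d :=
  lin_ext (fun t : assoc_basis r.+1 d => agen d (val t * s)%g).

Definition assoc_comp (r s d e : nat) (x : Assoc r.+1 d) (k : 'I_r.+1)
    (y : Assoc s.+1 e) : Assoc (r + s).+1 (d + e) :=
  bilin_ext (fun (u : assoc_basis r.+1 d) (v : assoc_basis s.+1 e) =>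
    agen (d + e) (pcomp (val u) k (val v))) x y.

Definition assoc_operad : dg_operad_data R :=
  @DgOperadData R Assoc (fun r d _ => 0) assoc_act (agen 0 1%g) assoc_comp.

(* The quotient of the free module on all (d+1)-tuples by the degenerate ones
   is the free module on the nondegenerate ones; [egen w] is the class in this
   quotient of an arbitrary tuple w, and is zero when w is degenerate. *)
Definition be_basis (r d : nat) := {w : d.+1.-tuple 'S_r | nondegenerate w}.
Definition BE (r d : nat) : lmodType R := freemod R (be_basis r d).

Definition egen (r d : nat) (w : seq 'S_r) : BE r d :=
  [ffun t => (tval (val t) == w)%:R].

Definition be_diff (r d : nat) : BE r.+1 d.+1 -> BE r.+1 d :=
  lin_ext (fun t : be_basis r.+1 d.+1 =>
    \sum_(i < d.+2) (-1) ^+ i *: egen d (delete_at i (val t))).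

Definition be_act (r d : nat) (s : 'S_r.+1) : BE r.+1 d -> BE r.+1 d :=
  lin_ext (fun t : be_basis r.+1 d => egen d [seq (w * s)%g | w <- val t]).

(* A lattice path from (0, 0) to (d, e) is a sequence of d + e steps, d of
   which are [true] (the x-steps), the others (the y-steps) being [false]. *)
Definition path_x (p : seq bool) (c : nat) : nat := count id (take c p).
Definition path_y (p : seq bool) (c : nat) : nat := count negb (take c p).

(* The number of inversions of the shuffle moving all x-steps before all
   y-steps. *)
Definition path_inv (p : seq bool) : nat :=
  (\sum_(j < size p) \sum_(i < j) (~~ nth true p i && nth false p j))%N.

Definition be_comp_gen (r s d e : nat) (u : seq 'S_r.+1) (k : 'I_r.+1)
    (v : seq 'S_s.+1) : BE (r + s).+1 (d + e) :=
  \sum_(p : (d + e).-tuple bool | count id p == d)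
    (-1) ^+ path_inv p *: egen (d + e)
      [seq pcomp (nth 1%g u (path_x p c)) k (nth 1%g v (path_y p c))
         | c <- iota 0 (d + e).+1].

Definition be_comp (r s d e : nat) (x : BE r.+1 d) (k : 'I_r.+1)
    (y : BE s.+1 e) : BE (r + s).+1 (d + e) :=
  bilin_ext (fun (u : be_basis r.+1 d) (v : be_basis s.+1 e) =>
    be_comp_gen d e (val u) k (val v)) x y.

Definition barratt_eccles : dg_operad_data R :=
  @DgOperadData R BE be_diff be_act (egen 0 [:: 1%g]) be_comp.

Definition be_filt_cond (n r : nat) (w : seq 'S_r) : bool :=
  [forall i : 'I_r, forall j : 'I_r, (i < j)%N ==>
    (variations [seq (index i (pseq x) < index j (pseq x))%N | x <- w]
       <= n.-1)%N].

(* Meaningful for n >= 1 only, because of the truncation in n.-1. *)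
Definition be_filt (n r d : nat) : BE r d -> Prop :=
  in_span (fun w : d.+1.-tuple 'S_r => be_filt_cond n w) (fun w => egen d w).

(* As above, [xgen u] is the class of the sequence u, which is zero when u is
   degenerate or not surjective. *)
Definition surj_basis (r d : nat) :=
  {u : (r + d).-tuple 'I_r | nondegenerate u && [forall x, x \in u]}.
Definition Surj (r d : nat) : lmodType R := freemod R (surj_basis r d).

Definition xgen (r d : nat) (u : seq 'I_r) : Surj r d :=
  [ffun t => (tval (val t) == u)%:R].

Definition surj_act (r d : nat) (s : 'S_r.+1) : Surj r.+1 d -> Surj r.+1 d :=
  lin_ext (fun t : surj_basis r.+1 d => xgen d [seq s x | x <- val t]).

Definition caesura (T : eqType) (u : seq T) (i : nat) : bool :=
  if drop i u is x :: u' then x \in u' else false.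

(* The index of the line of the table arrangement which contains position i;
   this is also the rank of position i among the caesuras if i is a caesura. *)
Definition table_line (T : eqType) (u : seq T) (i : nat) : nat :=
  count (caesura u) (iota 0 i).

(* The position of the last occurrence of x in u, if any. *)
Definition last_occurrence (T : eqType) (x : T) (u : seq T) : nat :=
  ((size u).-1 - index x (rev u))%N.

Definition surj_diff_sign (r : nat) (u : seq 'I_r.+1) (i : nat) : R :=
  let x := nth ord0 u i in
  if caesura u i then (-1) ^+ table_line u i
  else if x \in take i u then
    - (-1) ^+ table_line u (last_occurrence x (take i u))
  else 0.

Definition surj_diff (r d : nat) : Surj r.+1 d.+1 -> Surj r.+1 d :=
  lin_ext (fun t : surj_basis r.+1 d.+1 =>
    \sum_(i < r.+1 + d.+1)
      surj_diff_sign (val t) i *: xgen d (delete_at i (val t))).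

(* The degree of the segment (u_a, ..., u_b): the lines it meets are those of
   indices [table_line u a], ..., [table_line u b]. *)
Definition segment_deg (T : eqType) (u : seq T) (a b : nat) : nat :=
  (table_line u b - table_line u a)%N.

(* The sequence 0, i_1, ..., i_n, (size u).-1 where i_1 < ... < i_n are the
   positions of k in u. *)
Definition occ_bounds (r : nat) (u : seq 'I_r.+1) (k : 'I_r.+1) : seq nat :=
  0%N :: rcons [seq i <- iota 0 (size u) | nth ord0 u i == k] (size u).-1.

(* Here j is a sequence j_0, ..., j_n, and the occurrence of k at position p
   is preceded by [count_mem k (take p u)] other ones. *)
Definition surj_subst (r s : nat) (u : seq 'I_r.+1) (k : 'I_r.+1)
    (v : seq 'I_s.+1) (j : seq nat) : seq 'I_(r + s).+1 :=
  flatten [seq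
    let x := nth ord0 u p in
    let m := count_mem k (take p u) in
    if x == k then
      [seq shift_in k y | y <- segment (nth 0%N j m) (nth 0%N j m.+1) v]
    else [:: shift_out s k x] | p <- iota 0 (size u)].

(* The Koszul exponent of
   U_1 ... U_(n+1) V_1 ... V_n -> U_1 V_1 U_2 V_2 ... V_n U_(n+1):
   the factors V_(a+1) and U_(b+1) are exchanged iff a < b. *)
Definition surj_koszul (r s : nat) (u : seq 'I_r.+1) (k : 'I_r.+1)
    (v : seq 'I_s.+1) (j : seq nat) : nat :=
  let i := occ_bounds u k in
  (\sum_(b < (count_mem k u).+1) \sum_(a < b)
     segment_deg v (nth 0 j a) (nth 0 j a.+1) *
     segment_deg u (nth 0 i b) (nth 0 i b.+1))%N.

Definition surj_comp_gen (r s d e : nat) (u : seq 'I_r.+1) (k : 'I_r.+1)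
    (v : seq 'I_s.+1) : Surj (r + s).+1 (d + e) :=
  \sum_(j : (count_mem k u).+1.-tuple 'I_(s.+1 + e)
        | let j' := map val j in
          [&& sorted leq j', head 0%N j' == 0%N & last 0%N j' == (s + e)%N])
    (-1) ^+ surj_koszul u k v (map val j) *:
    xgen (d + e) (surj_subst u k v (map val j)).

Definition surj_comp (r s d e : nat) (x : Surj r.+1 d) (k : 'I_r.+1)
    (y : Surj s.+1 e) : Surj (r + s).+1 (d + e) :=
  bilin_ext (fun (u : surj_basis r.+1 d) (v : surj_basis s.+1 e) =>
    surj_comp_gen d e (val u) k (val v)) x y.

Definition surjection_operad : dg_operad_data R :=
  @DgOperadData R Surj surj_diff surj_act (xgen 0 [:: ord0]) surj_comp.

Definition surj_filt_cond (n r : nat) (u : seq 'I_r) : bool :=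
  [forall i : 'I_r, forall j : 'I_r, (i < j)%N ==>
    (variations [seq x <- u | (x == i) || (x == j)] <= n)%N].

Definition surj_filt (n r d : nat) : Surj r d -> Prop :=
  in_span (fun u : (r + d).-tuple 'I_r => surj_filt_cond n u)
    (fun u => xgen d u).

(* [seen] collects the non-final entries of the preceding lines. *)
Fixpoint table_seq (r : nat) (seen : seq 'I_r) (w : seq 'S_r) (n : seq nat) :
    seq 'I_r :=
  match w, n with
  | w0 :: w', n0 :: n' =>
    let line := take n0 [seq x <- pseq w0 | x \notin seen] in
    line ++ table_seq (seen ++ take (size line).-1 line) w' n'
  | _, _ => [::]
  end.

Definition table_reduction_gen (r d : nat) (w : seq 'S_r) : Surj r d :=
  \sum_(n : d.+1.-tuple 'I_(r + d).+1
        | let n' := map val n in all (leq 1) n' && (sumn n' == r + d)%N)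
    xgen d (table_seq [::] w (map val n)).

(* That TR is also given by this formula on degenerate tuples, whose class is
   zero, is a property of [table_reduction_gen]. *)
Definition table_reduction (r d : nat) : BE r d -> Surj r d :=
  lin_ext (fun t : be_basis r d => table_reduction_gen d (val t)).

Definition assoc_to_be (r d : nat) : Assoc r d -> BE r d :=
  lin_ext (fun t : assoc_basis r d => egen d [:: val t]).

Definition assoc_to_surj (r d : nat) : Assoc r d -> Surj r d :=
  lin_ext (fun t : assoc_basis r d => xgen d (pseq (val t))).

End Operads.

(* Main.v *)
From mathcomp Require Import all_boot all_order all_algebra all_fingroup.
From mathcomp Require Import zify ring.
Require Import Defs.

Set Implicit Arguments.
Unset Strict Implicit.
Unset Printing Implicit Defensive.

Import GRing.Theory.
Local Open Scope ring_scope.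

(** A surjection occurs in TR(w_0, ..., w_d) with coefficient 0 or 1, and the
coefficient can be tested term by term: u occurs if and only if each term u(p),
placed on line i of the table arrangement of u, precedes in w_i every other value
which u takes after p ([fits], [table_reduction_coef]).  Indeed the non-final
entries of the preceding lines are exactly the values which have already
occurred for the last time, and a line ends where a value recurs.  The
condition at p involves the tail of u from p on and nothing else, so that every
identity below is proved by recursion on u.

One remark is used over and over: if the caesura x which ends a line and the
entry y which starts the next line are ordered by the same permutation, then x
precedes y and y precedes x, because x recurs; hence x = y and u is degenerate.
It follows that degenerate tuples have image zero ([fits_repeat]).

Differential.  The coefficient of u in TR(delta w) is the alternating sum of
the conditions that u fits w with one permutation omitted; in delta(TR(w)) it
is a signed sum over the insertions of one more term into u which yield a table
fitting w.  Let y be the first term of u, and let g0, g1 tell whether y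
precedes the rest of u in w_0, w_1.  In front of y only the least remaining
value of w_0 can be inserted, which contributes when g0 = 0
([sum_other_min]); a further copy of y, when y does not recur, can be inserted
at exactly one place ([sum_fits_insert_at]); the other insertions take place in
the rest of u.  Both sides thus satisfy the same recursion
([insertion_sum_cons], [sum_fits_delete]).

Composition.  A composite surjection z reads two sequences a and b along a word
of steps, each of which advances in a or in b, where b may advance only while a
stands at k ([interleave], [grafting]; [steps] translates the cut points j_m
into such a word).  If z fits the term of the composite of the tuples u and v
which belongs to a shuffle p, then p is determined by z: at a caesura of z, a
step of p in the wrong factor would leave the permutation comparing the two
neighbouring terms unchanged, which is excluded by the remark above.  So no two
shuffles contribute to the same z.  Moreover z is then a composite of unique a
and b ([exists_grafting], [interleave_inj]), the shuffle p consists of the steps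
taken at the caesuras of z, z fits if and only if a fits u and b fits v
([fits_interleave]), and the Koszul exponent of the composite is the number of
inversions of p ([cut_koszul]).

Surjectivity.  Each basis element u is the image of a single tuple: w_i lists
the values which are finished before line i, in their order of appearance, and
then the other ones in the order of their first occurrence from line i on.  A
table with a line shorter or longer than that of u would start its next line
with the entry which ended this one ([exists_perms_fitting_only]).

Filtrations.  When the terms i and j of u alternate, the line on which a letter
precedes the other one must order them accordingly, so each alternation but the
first requires a change of the order of i and j in w ([fits_variations]).  In
degree 0 a sequence fits (w_0) only if it is the sequence of values of w_0,
and the first layers vanish in positive degrees; this gives the statements on
the associative operad. *)

(** * Linear and bilinear extensions *)

Section LinExt.
Variable R : comPzRingType.

Lemma lin_ext_linear (T : finType) (M : lmodType R) (g : T -> M) :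
  linear (lin_ext g).
Proof.
move=> c x y; rewrite /lin_ext scaler_sumr -big_split; apply: eq_bigr => t _ /=.
by rewrite !ffunE scalerDl scalerA.
Qed.

Lemma lin_ext0 (T : finType) (M : lmodType R) (g : T -> M) : lin_ext g 0 = 0.
Proof. by rewrite /lin_ext big1 // => t _; rewrite ffunE scale0r. Qed.

Lemma lin_extZ (T : finType) (M : lmodType R) (g : T -> M) c x :
  lin_ext g (c *: x) = c *: lin_ext g x.
Proof. by rewrite -[c *: x]addr0 lin_ext_linear lin_ext0 addr0. Qed.

Lemma lin_ext_sum (T I : finType) (P : pred I) (M : lmodType R) (g : T -> M) F :
  lin_ext g (\sum_(i | P i) F i) = \sum_(i | P i) lin_ext g (F i).
Proof.
apply: (big_morph (lin_ext g)) => [x y|]; last exact: lin_ext0.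
by rewrite -[x]scale1r lin_ext_linear !scale1r.
Qed.

Lemma lin_ext_comp (S T : finType) (M : lmodType R) (g : T -> M)
    (h : S -> freemod R T) x :
  lin_ext g (lin_ext h x) = lin_ext (fun s => lin_ext g (h s)) x.
Proof. by rewrite lin_ext_sum; apply: eq_bigr => s _; rewrite lin_extZ. Qed.

Lemma eq_lin_ext (T : finType) (M : lmodType R) (g h : T -> M) x :
  g =1 h -> lin_ext g x = lin_ext h x.
Proof. by move=> gh; apply: eq_bigr => t _; rewrite gh. Qed.

Lemma lin_ext_coef (S T : finType) (h : S -> freemod R T) x t :
  lin_ext h x t = \sum_s (x s : R) * (h s t : R).
Proof. by rewrite sum_ffunE; apply: eq_bigr => s _; rewrite ffunE. Qed.

Lemma lin_ext_delta (T : finType) (M : lmodType R) (g : T -> M) t :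
  lin_ext g [ffun s => (s == t)%:R] = g t.
Proof.
rewrite /lin_ext (bigD1 t) //= big1 ?ffunE ?eqxx ?scale1r ?addr0 // => s /negbTE st.
by rewrite ffunE st scale0r.
Qed.

Lemma freemod_delta (T : finType) (x : freemod R T) :
  x = lin_ext (M := freemod R T) (fun t => [ffun s => (s == t)%:R]) x.
Proof.
apply/ffunP=> t; rewrite lin_ext_coef (bigD1 t) //= ffunE eqxx mulr1.
by rewrite big1 ?addr0 // => s /negbTE st; rewrite ffunE eq_sym st mulr0.
Qed.

Lemma bilin_ext_lin (S T S' T' : finType) (M : lmodType R) (h : S -> T -> M)
    (f : S' -> freemod R S) (g : T' -> freemod R T) x y :
  bilin_ext h (lin_ext f x) (lin_ext g y) =
  bilin_ext (fun s t => bilin_ext h (f s) (g t)) x y.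
Proof.
rewrite /bilin_ext.
transitivity (\sum_s \sum_t \sum_s' \sum_t'
   ((x s' : R) * (f s' s : R) * ((y t' : R) * (g t' t : R))) *: h s t).
  apply: eq_bigr => s _; apply: eq_bigr => t _.
  rewrite !lin_ext_coef mulr_suml scaler_suml; apply: eq_bigr => s' _.
  by rewrite mulr_sumr scaler_suml.
under eq_bigr => s _ do rewrite exchange_big /=.
rewrite exchange_big /=; apply: eq_bigr => s' _.
under eq_bigr => s _ do rewrite exchange_big /=.
rewrite exchange_big /=.
rewrite [LHS](eq_bigr (fun t' => \sum_s \sum_t
  ((x s' : R) * (f s' s : R) * ((y t' : R) * (g t' t : R))) *: h s t)); last first.
  by move=> t' _; apply: eq_bigr => s _.
apply: eq_bigr => t' _; rewrite scaler_sumr; apply: eq_bigr => s _.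
rewrite scaler_sumr; apply: eq_bigr => t _; rewrite scalerA; congr (_ *: _).
by rewrite -!mulrA; congr (_ * _); rewrite mulrCA.
Qed.

Lemma lin_ext_bilin (S T U : finType) (M : lmodType R) (g : U -> M)
    (h : S -> T -> freemod R U) x y :
  lin_ext g (bilin_ext h x y) = bilin_ext (fun s t => lin_ext g (h s t)) x y.
Proof.
rewrite lin_ext_sum; apply: eq_bigr => s _; rewrite lin_ext_sum.
by apply: eq_bigr => t _; rewrite lin_extZ.
Qed.

Lemma eq_bilin_ext (S T : finType) (M : lmodType R) (g h : S -> T -> M) x y :
  (forall s t, g s t = h s t) -> bilin_ext g x y = bilin_ext h x y.
Proof.
by move=> gh; apply: eq_bigr => s _; apply: eq_bigr => t _; rewrite gh.
Qed.

End LinExt.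

(** * Tables which fit a tuple of permutations *)

Section Fits.
Local Open Scope nat_scope.
Variable n : nat.
Implicit Types (u v : seq 'I_n) (w : seq 'S_n) (s : 'S_n) (x y : 'I_n).

(** A non-strict comparison: caesuras are compared with their own later
occurrences. *)
Definition prec s (x y : 'I_n) : bool := (s^-1%g x <= s^-1%g y)%N.

Lemma prec_refl s x : prec s x x. Proof. exact: leqnn. Qed.

Lemma prec_trans s : transitive (prec s).
Proof. by move=> y x z; apply: leq_trans. Qed.

Lemma prec_anti s x y : prec s x y -> prec s y x -> x = y.
Proof.
move=> xy yx; have /eqP/val_inj/perm_inj // : s^-1%g x == s^-1%g y :> nat.
by rewrite eqn_leq; apply/andP.
Qed.

Lemma prec_total s x y : prec s x y || prec s y x.
Proof. exact: leq_total. Qed.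

Lemma precNE s x y : x != y -> prec s y x = ~~ prec s x y.
Proof.
move=> xy; case: (boolP (prec s x y)) => [pxy|]; last first.
  by have := prec_total s x y; case: (prec s x y).
by apply: contraNF xy => pyx; rewrite (prec_anti pxy pyx).
Qed.

Lemma sorted_pseq s : sorted (prec s) (pseq s).
Proof.
rewrite sorted_map; have := iota_sorted 0 n; rewrite -val_enum_ord sorted_map.
by apply: sub_sorted => i j /= ij; rewrite /prec !permK.
Qed.

(** The term x, lying on the line of the first permutation of w, precedes
all later terms; the next permutation is used after a caesura.  The default
value of [head] is never read when w has more entries than u has caesuras. *)
Fixpoint fits u w : bool :=
  if u is x :: u' then
    all (prec (head 1%g w) x) u' && fits u' (if x \in u' then behead w else w)
  else true.

Fixpoint ncaes (T : eqType) (u : seq T) : nat :=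
  if u is x :: u' then (x \in u') + ncaes u' else 0.

(** At the first caesura of u the reading passes from w0 to w1.  As these
agree on the values of u, the caesura and the next term precede each other, so
they are equal. *)
Lemma fits_repeat u (w0 w1 : 'S_n) w :
  fits u [:: w0, w1 & w] -> (forall x y, x \in u -> y \in u -> prec w0 x y = prec w1 x y) ->
  0 < ncaes u -> ~~ nondegenerate u.
Proof.
elim: u => //= x u IH /andP[/allP xu fu] w01 cu.
case: u xu fu IH w01 cu => //= y u xu fu IH w01 cu.
rewrite negb_and negbK; apply/orP.
move: fu; rewrite in_cons; case: (boolP ((x == y) || (x \in u))) => xyu; last first.
  move=> fu; right; apply: (IH fu) => [a b au bu|].
    by rewrite w01 // in_cons ?au ?bu orbT.
  by move: cu; rewrite in_cons (negbTE xyu).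
move=> /= /andP[/allP yu _]; left; apply/eqP.
case/orP: xyu => [/eqP //|xu'].
have y2 : y \in [:: x, y & u] by rewrite !in_cons eqxx orbT.
have x2 : x \in [:: x, y & u] by rewrite !in_cons eqxx.
apply: (@prec_anti w0); first by apply: xu; rewrite in_cons eqxx.
by rewrite w01 //; apply: yu.
Qed.

Lemma fits_nondegenerate u w :
  fits u w -> nondegenerate u -> size w = (ncaes u).+1 -> nondegenerate w.
Proof.
elim: u w => [|x u IH] [|w0 w] //=; first by case: w.
move=> fu nu; have nu' : nondegenerate u by case/andP: nu.
case: ifP fu => xu /andP[px fu] /=; last by move=> [sw]; apply: IH fu nu' _; rewrite /= sw.
move=> [sw]; have nw := IH _ fu nu' sw.
case: w sw nw fu => [//|w1 w] sw nw fu; rewrite nw andbT.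
apply/eqP=> w01; subst w1.
suff: ~~ nondegenerate (x :: u) by move/negP; apply.
by apply: (@fits_repeat _ w0 w0 w); rewrite //= xu ?px.
Qed.

End Fits.

Section Caesuras.
Local Open Scope nat_scope.
Variable T : eqType.
Implicit Type u : seq T.

Lemma caesura_cons x u i : caesura (x :: u) i.+1 = caesura u i.
Proof. by []. Qed.

Lemma caesura0 x u : caesura (x :: u) 0 = (x \in u). Proof. by []. Qed.

Lemma table_line_cons x u i :
  table_line (x :: u) i.+1 = (x \in u) + table_line u i.
Proof.
rewrite /table_line /= caesura0; congr (_ + _).
by rewrite -(addn0 1) iotaDl count_map; apply: eq_count.
Qed.

(** A term is either a caesura or the last occurrence of its value. *)
Lemma size_ncaes u : size u = size (undup u) + ncaes u.
Proof. by elim: u => //= x u ->; case: (x \in u); rewrite /= ?addSn ?addnS. Qed.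

End Caesuras.

Lemma uniq_ncaes (T : eqType) (u : seq T) : uniq u = (ncaes u == 0%N).
Proof. by elim: u => //= x u ->; rewrite addn_eq0 eqb0. Qed.

Lemma size_undup_full n (u : seq 'I_n) : (forall x, x \in u) -> size (undup u) = n.
Proof.
move=> fu; rewrite -[RHS]card_ord cardE; apply/perm_size/uniq_perm.
- exact: undup_uniq.
- exact: enum_uniq.
by move=> x; rewrite mem_undup fu mem_enum.
Qed.

Lemma basis_ncaes r d (u : surj_basis r d) : ncaes (val u) = d.
Proof.
case: u => u /= /andP[_ /forallP fu]; apply/eqP.
by rewrite -(eqn_add2l r) -{1}(size_undup_full fu) -size_ncaes size_tuple.
Qed.

Lemma all_cons (T : Type) (a : pred T) x u : all a (x :: u) = a x && all a u.
Proof. by []. Qed.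

Lemma nondegenerate_cons2 (T : eqType) (x y : T) u :
  nondegenerate [:: x, y & u] = (x != y) && nondegenerate (y :: u).
Proof. by []. Qed.

Lemma ncaes_cons (T : eqType) (x : T) u : ncaes (x :: u) = ((x \in u) + ncaes u)%N.
Proof. by []. Qed.

Lemma fits_cons n (x : 'I_n) u w :
  fits (x :: u) w =
  all (prec (head 1%g w) x) u && fits u (if x \in u then behead w else w).
Proof. by []. Qed.

(** * The coefficients of the table reduction *)

Section TableSeq.
Local Open Scope nat_scope.
Variable r : nat.
Implicit Types (seen u : seq 'I_r) (w : seq 'S_r) (n : seq nat).

Lemma eq_table_seq seen1 seen2 w n :
  seen1 =i seen2 -> table_seq seen1 w n = table_seq seen2 w n.
Proof.
elim: w n seen1 seen2 => [|w0 w IH] [|n0 n] seen1 seen2 //= E.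
rewrite (@eq_filter _ _ [pred x | x \notin seen2]) => [|x /=]; last by rewrite E.
by congr (_ ++ _); apply: IH => x; rewrite !mem_cat E.
Qed.

Lemma mem_table_seq seen w n x : x \in table_seq seen w n -> x \notin seen.
Proof.
elim: w n seen => [|w0 w IH] [|n0 n] seen //=.
rewrite mem_cat => /orP[/mem_take|/IH]; first by rewrite mem_filter => /andP[].
by rewrite mem_cat negb_or => /andP[].
Qed.

(** The non-final entries of a line do not recur, so that its last entry
is the only possible caesura. *)
Lemma ncaes_line (T : eqType) (l v : seq T) :
  uniq l -> (forall x, x \in take (size l).-1 l -> x \notin v) ->
  ncaes (l ++ v) <= (v != [::]) + ncaes v.
Proof.
elim: l => [|x l IH] /=; first by rewrite leq_addl.
move=> /andP[xl ul] H; rewrite mem_cat (negbTE xl) /=.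
case: l xl ul IH H => [_ _ _ _|y l xl ul IH H].
  by rewrite /= leq_add2r; case: v => // *; apply: leq_b1.
rewrite (negbTE (H x _)) /= ?in_cons ?eqxx // add0n; apply: IH => // z zl.
by apply: H; rewrite /= in_cons; case: (l) zl => //= *; apply/orP; right.
Qed.

Lemma ncaes_table_seq seen w n : ncaes (table_seq seen w n) <= (size w).-1.
Proof.
elim: w n seen => [|w0 w IH] [|n0 n] seen //=; set l := take n0 _.
have ul : uniq l by apply/take_uniq/filter_uniq/pseq_uniq.
apply: leq_trans (ncaes_line ul _) _ => [x xl|].
  by apply: contraL xl => /mem_table_seq; rewrite mem_cat negb_or => /andP[].
case: w IH => [|w1 w] IH; first by case: (n).
by apply: leq_add (leq_b1 _) (IH _ _).
Qed.

(** The lengths of the lines of the table arrangement: a line ends just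
after a caesura. *)
Fixpoint line_lengths (T : eqType) (u : seq T) : seq nat :=
  if u is x :: u' then
    if x \in u' then 1 :: line_lengths u'
    else if line_lengths u' is l :: ls then l.+1 :: ls else [:: 1]
  else [::].

Lemma line_lengths_nil (T : eqType) (u : seq T) : (line_lengths u == [::]) = (u == [::]).
Proof. by case: u => //= x u; case: ifP => //; case: line_lengths. Qed.

Lemma line_lengths_gt0 (T : eqType) (u : seq T) : all (leq 1) (line_lengths u).
Proof.
elim: u => //= x u IH; case: ifP => //=.
by case: line_lengths IH => //= l ls /andP[_ ->].
Qed.

Lemma sumn_line_lengths (T : eqType) (u : seq T) : sumn (line_lengths u) = size u.
Proof.
elim: u => //= x u <-; case: ifP => //= _.
by case E: line_lengths => [|l ls].
Qed.

Lemma size_line_lengths (T : eqType) (u : seq T) :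
  u != [::] -> size (line_lengths u) = (ncaes u).+1.
Proof.
elim: u => //= x u IH _; have [xu|xu] := boolP (x \in u).
  by rewrite /= IH //; case: (u) xu.
rewrite add0n; case: u IH {xu} => [|y u] // /(_ isT).
by case: line_lengths => [|l ls].
Qed.

Lemma leq_sumn (l : nat) (s : seq nat) : l \in s -> l <= sumn s.
Proof.
elim: s => //= a s IH; rewrite in_cons => /predU1P[->|/IH ls]; first exact: leq_addr.
exact: leq_trans ls (leq_addl _ _).
Qed.

(** What is left of the sequence of values of w0 is sorted for w0, so it
starts with its least element. *)
Lemma head_unseen seen (w0 : 'S_r) (x f : 'I_r) u F :
  [seq y <- pseq w0 | y \notin seen] = f :: F ->
  (forall y, (y \in x :: u) = (y \notin seen)) ->
  (f == x) = all (prec w0 x) u.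
Proof.
move=> EF T.
have sp : sorted (prec w0) (f :: F).
  by rewrite -EF; apply: sorted_filter (sorted_pseq w0); apply: prec_trans.
have fm y : y \in x :: u -> prec w0 f y.
  rewrite T => ys; have : y \in f :: F by rewrite -EF mem_filter ys mem_pseq.
  rewrite in_cons => /predU1P[->|yF]; first exact: prec_refl.
  have := order_path_min (@prec_trans _ w0) sp; move/allP; exact.
apply/eqP/allP => [<- y yu|xm]; first by apply: fm; rewrite in_cons yu orbT.
apply: (@prec_anti _ w0); first by apply: fm; rewrite in_cons eqxx.
have : f \in x :: u.
  have : f \in f :: F by rewrite in_cons eqxx.
  by rewrite T -EF mem_filter => /andP[].
by rewrite in_cons => /predU1P[->|/xm //]; apply: prec_refl.
Qed.

(** The table arrangement is determined by u, so a choice of line lengths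
produces u only if it is [line_lengths u].  The induction is on the terms of u
instead of its lines: a line of length at least 2 starting with x is x followed
by a shorter line for which x has been seen.  A line cut too early is excluded
by counting caesuras, and one continued beyond a caesura x would have to omit x
from then on. *)
Lemma table_seq_fits seen w n u :
  nondegenerate u -> (forall x, (x \in u) = (x \notin seen)) ->
  size w = (ncaes u).+1 -> all (leq 1) n -> size n = size w -> sumn n = size u ->
  (table_seq seen w n == u) = fits u w && (n == line_lengths u).
Proof.
elim: u seen w n => [|x u IH] seen w n nu T sw n1 sn nn.
  by case: n w n1 sn sw nn => [|[|?] ?] [|? ?].
case: w sw sn => [//|w0 w] [] sw; case: n n1 nn => [//|n0 n] /andP[n0_gt0 n1] nn [sn].
have nu' : nondegenerate u by case/andP: nu.
have xs : x \notin seen by rewrite -T in_cons eqxx.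
have xF : x \in [seq y <- pseq w0 | y \notin seen] by rewrite mem_filter xs mem_pseq.
rewrite /=; case EF: [seq y <- pseq w0 | y \notin seen] xF => [//|f F] xF.
rewrite -(head_unseen EF T).
case: n0 n0_gt0 nn => [//|[|m]] _ /=; rewrite ?take0 /=.
  move=> [nn]; rewrite cats0 eqseq_cons; case: (eqVneq f x) => //= fx.
  have [xu|xu] := boolP (x \in u).
    rewrite IH //= ?eqseq_cons ?eqxx //.
    - move=> y; rewrite -T in_cons; case: eqVneq => [->|//]; by rewrite xu.
    - by rewrite sw xu.
  (* A line of length 1 ending with a value which does not recur is the last. *)
  have E1 : ([:: 1 & n] == match line_lengths u with [::] => [:: 1] | l :: ls => l.+1 :: ls end)
    = (u == [::]).
    rewrite -line_lengths_nil; case E: line_lengths => [|[|l] ls] /=.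
    - rewrite eqseq_cons eqxx /=; have /eqP := E; rewrite line_lengths_nil => /eqP u0.
      move: sn; rewrite sw u0 /=; by case: (n).
    - by have := line_lengths_gt0 u; rewrite E.
    - by rewrite eqseq_cons.
  rewrite E1; case: (eqVneq u [::]) => u0.
    move: sw; rewrite u0 /=; by case: (w); case: (n).
  rewrite andbF; apply/eqP => tu; have := ncaes_table_seq seen w n.
  rewrite tu; move: sw; rewrite (negbTE xu) add0n => <-.
  by case: (w) tu => [|w1 w'] /=; [move=> u0'; rewrite -u0' in u0 | rewrite ltnn].
move=> [nn].
case: F EF xF => [|f' F] EF xF.
  have Tx y : y \in x :: u -> y = x.
    move: xF; rewrite T mem_seq1 => /eqP -> ys.
    have : y \in [:: f] by rewrite -EF mem_filter ys mem_pseq.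
    by rewrite mem_seq1 => /eqP.
  case: u nu Tx nn sn {IH sw T nu'} => [|y u] nu Tx; first by rewrite addSn.
  by have := Tx y; rewrite !in_cons eqxx orbT => /(_ isT) yx; rewrite yx /= eqxx in nu.
rewrite /= eqseq_cons; case: (eqVneq f x) => //= fx.
set v := (X in X == u).
have Ev : v = table_seq (x :: seen) (w0 :: w) (m.+1 :: n).
  rewrite /v /= (_ : [seq y <- pseq w0 | y \notin x :: seen] = f' :: F) /=.
    by congr (_ :: _ ++ _); apply: eq_table_seq => y; rewrite !inE !mem_cat !inE fx;
      do !case: (_ == _); do !case: (_ \in _).
  have : uniq (f :: f' :: F) by rewrite -EF filter_uniq ?pseq_uniq.
  rewrite -fx => /andP[fF _].
  transitivity [seq y <- [seq y <- pseq w0 | y \notin seen] | y != f].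
    rewrite -filter_predI; apply: eq_filter => y /=; by rewrite in_cons negb_or.
  rewrite EF; move: (f' :: F) fF => G fF /=; rewrite eqxx /=.
  apply/all_filterP/allP => y yF; apply: contraNneq fF => <-; exact: yF.
have [xu|xu] := boolP (x \in u).
  rewrite eqseq_cons andbF; apply/eqP => vu.
  by move: xu; rewrite -vu Ev => /mem_table_seq; rewrite in_cons eqxx.
rewrite Ev IH //=.
- congr (_ && _); by case: line_lengths => [|l ls]; rewrite ?eqseq_cons.
- move=> y; rewrite in_cons negb_or -T in_cons.
  by case: eqVneq => [->|//]; rewrite (negbTE xu).
- by rewrite sw (negbTE xu).
- by rewrite sn.
Qed.

End TableSeq.

Section Coefficient.
Variable R : comPzRingType.

Lemma xgen_coef r d (u : seq 'I_r) (t : surj_basis r d) :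
  xgen R d u t = (tval (val t) == u)%:R.
Proof. by rewrite ffunE. Qed.

Lemma egen_coef r d (w : seq 'S_r) (t : be_basis r d) :
  egen R d w t = (tval (val t) == w)%:R.
Proof. by rewrite ffunE. Qed.

Lemma xgen_basis r d (t : surj_basis r d) : xgen R d (val t) = [ffun s => (s == t)%:R].
Proof. by apply/ffunP=> s; rewrite !ffunE. Qed.

Lemma egen_basis r d (t : be_basis r d) : egen R d (val t) = [ffun s => (s == t)%:R].
Proof. by apply/ffunP=> s; rewrite !ffunE. Qed.

Lemma table_reduction_coef r d (w : seq 'S_r.+1) (u : surj_basis r.+1 d) :
  size w = d.+1 -> table_reduction_gen R d w u = (fits (val u) w)%:R.
Proof.
move=> sw; rewrite sum_ffunE.
have /andP[nu fu] := valP u.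
have su := size_tuple (val u); have cu := basis_ncaes u.
have u0 : tval (val u) != [::] by case: (tval _) su.
pose b := (r.+1 + d)%N.
have Lb : all (fun l => l <= b)%N (line_lengths (val u)).
  by apply/allP => l /leq_sumn; rewrite sumn_line_lengths su.
have sL : size (line_lengths (val u)) = d.+1 by rewrite size_line_lengths // cu.
have sL' : size (map (@inord b) (line_lengths (val u))) == d.+1 by rewrite size_map sL.
pose L := Tuple sL'.
have LE : map val L = line_lengths (val u).
  rewrite /= -map_comp -[RHS]map_id; apply/eq_in_map => l lL /=.
  by rewrite inordK // ltnS; apply: (allP Lb).
rewrite (bigD1 L) /=; last first.
  by rewrite LE line_lengths_gt0 sumn_line_lengths su eqxx.
rewrite big1 ?addr0 => [|n /andP[/andP[n1 /eqP nn] nL]]; rewrite xgen_coef eq_sym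
  table_seq_fits ?LE ?eqxx ?andbT ?sL ?sw ?cu ?size_map ?size_tuple ?line_lengths_gt0
    ?sumn_line_lengths ?su //.
- by move=> x; rewrite (forallP fu x) in_nil.
- rewrite (_ : _ == _ = false) ?andbF // -LE; apply: contraNF nL => /eqP/(inj_map val_inj) E.
  by apply/eqP/val_inj.
- by move=> x; rewrite (forallP fu x) in_nil.
Qed.

(** A nondegenerate table with d caesuras fits no degenerate tuple of d + 1
permutations, so the defining sum of a degenerate tuple vanishes. *)
Lemma table_reduction_egen r d (w : d.+1.-tuple 'S_r.+1) :
  table_reduction (egen R d w) = table_reduction_gen R d w.
Proof.
have [nw|nw] := boolP (nondegenerate w).
  pose t : be_basis r.+1 d := Sub w nw.
  by rewrite -[tval w]/(tval (val t)) egen_basis /table_reduction lin_ext_delta.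
rewrite (_ : egen R d w = 0) ?[LHS]lin_ext0; last first.
  apply/ffunP => t; rewrite egen_coef ffunE; case: eqVneq => // E.
  by move: (valP t) nw; rewrite -E => ->.
apply/ffunP => u; rewrite table_reduction_coef ?size_tuple // ffunE.
case: (boolP (fits _ _)) => // fu; case/negP: nw.
have /andP[nu _] := valP u.
by apply: fits_nondegenerate fu nu _; rewrite size_tuple basis_ncaes.
Qed.

End Coefficient.

(** * The differential *)

Section Insertion.
Variable R : comPzRingType.

Definition insert_at (T : Type) p (x : T) u := take p u ++ x :: drop p u.

Lemma natr_andb (a b : bool) : (a && b)%:R = a%:R * b%:R :> R.
Proof. by case: a; case: b; rewrite ?mulr0 ?mulr1. Qed.

Lemma natr_negb (a : bool) : (~~ a)%:R = 1 - a%:R :> R.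
Proof. by case: a; rewrite ?subrr ?subr0. Qed.

Lemma insert_at0 (T : Type) (x : T) u : insert_at 0 x u = x :: u.
Proof. by rewrite /insert_at take0 drop0. Qed.

Lemma mem_insert_at (T : eqType) p (x y : T) u :
  (y \in insert_at p x u) = (y == x) || (y \in u).
Proof.
rewrite mem_cat in_cons orbCA -mem_cat cat_take_drop; by [].
Qed.

Lemma all_insert_at (T : Type) (a : pred T) p x u :
  all a (insert_at p x u) = a x && all a u.
Proof. by rewrite all_cat /= andbCA -all_cat cat_take_drop. Qed.

Lemma size_insert_at (T : Type) p (x : T) u : size (insert_at p x u) = (size u).+1.
Proof. by rewrite size_cat /= addnS -size_cat cat_take_drop. Qed.

Lemma nth_insert_at (T : Type) (x0 : T) p x u :
  (p <= size u)%N -> nth x0 (insert_at p x u) p = x.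
Proof. by move=> pu; rewrite nth_cat size_takel // ltnn subnn. Qed.

Lemma count_insert_at (T : Type) (a : pred T) p x u :
  count a (insert_at p x u) = (a x + count a u)%N.
Proof. by rewrite count_cat /= addnCA -count_cat cat_take_drop. Qed.

Lemma delete_insert_at (T : Type) p (x : T) u :
  (p <= size u)%N -> delete_at p (insert_at p x u) = u.
Proof.
move=> pu; rewrite /delete_at /insert_at take_size_cat ?size_takel //.
by rewrite drop_cat size_takel // ltnNge leqnSn /= subSnn /= drop0 cat_take_drop.
Qed.

Lemma insert_delete_at (T : Type) (x0 : T) p u :
  (p < size u)%N -> insert_at p (nth x0 u p) (delete_at p u) = u.
Proof.
move=> pu; rewrite /delete_at /insert_at take_size_cat ?size_takel 1?ltnW //.
by rewrite drop_size_cat ?size_takel 1?ltnW // -drop_nth // cat_take_drop.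
Qed.

Lemma size_delete_at (T : Type) p (u : seq T) :
  (p < size u)%N -> size (delete_at p u) = (size u).-1.
Proof.
move=> pu; rewrite size_cat size_takel ?(ltnW pu) // size_drop; lia.
Qed.

Lemma nondegenerate_insert_at (T : eqType) p (y : T) u :
  y \notin u -> nondegenerate u -> nondegenerate (insert_at p y u).
Proof.
rewrite /insert_at; elim: u p => [|x u IH] [|p] //=.
  by rewrite in_cons negb_or => /andP[-> _] ->.
rewrite in_cons negb_or => /andP[yx yu] /andP[xu nu].
rewrite IH // andbT; case: p => [|p]; first by rewrite take0 /= eq_sym.
by case: (u) xu => //= _; rewrite eq_sym.
Qed.

Section Signs.
Variable r : nat.
Implicit Types (v : seq 'I_r.+1).

Lemma surj_diff_sign0 y v : surj_diff_sign R (y :: v) 0 = (y \in v)%:R.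
Proof. by rewrite /surj_diff_sign /= caesura0; case: ifP. Qed.

(** Adding a first term y with a later occurrence increases the rank of
all caesuras by one.  The exceptional sign concerns a value y which occurs only
once in v: its occurrence becomes a last one, preceded by the caesura y of
rank 0. *)
Lemma surj_diff_signS y v p : (p < size v)%N ->
  surj_diff_sign R (y :: v) p.+1 =
  if y \in v then
    if (nth ord0 v p == y) && (count_mem y v == 1%N) then -1
    else - surj_diff_sign R v p
  else surj_diff_sign R v p.
Proof.
move=> pv; rewrite /surj_diff_sign /= caesura_cons table_line_cons.
set x := nth ord0 v p; have xv : x \in v by apply: mem_nth.
have vE : v = take p v ++ x :: drop p.+1 v by rewrite -drop_nth // cat_take_drop.
have cE : caesura v p = (x \in drop p.+1 v).
  by rewrite /caesura (drop_nth ord0 pv).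
have [xc|xc] := boolP (caesura v p).
  rewrite exprD; have [yv|yv] := boolP (y \in v); last by rewrite mul1r.
  rewrite expr1 mulN1r ifF //; apply/negP => /andP[/eqP xy].
  rewrite {1}vE count_cat /= xy eqxx add1n eqn_leq => /andP[+ _].
  by move: xc; rewrite cE xy -has_pred1 has_count; set A := count _ _; set B := count _ _; lia.
have L t : x \in t -> last_occurrence x (y :: t) = (last_occurrence x t).+1.
  move=> xt; rewrite /last_occurrence rev_cons -cats1 index_cat mem_rev xt /=.
  have : (index x (rev t) < size t)%N by rewrite -[size t]size_rev index_mem mem_rev.
  by move: (index _ _) (size t) => a b; lia.
rewrite in_cons; have [xt|xt] := boolP (x \in take p v).
  rewrite orbT L // table_line_cons exprD.
  have [yv|yv] := boolP (y \in v); last by rewrite mul1r.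
  rewrite expr1 mulN1r ifF //; apply/negP => /andP[/eqP xy].
  rewrite {1}vE count_cat /= xy eqxx add1n eqn_leq => /andP[+ _].
  by move: xt; rewrite xy -has_pred1 has_count; set A := count _ _; set B := count _ _; lia.
rewrite orbF; case: eqVneq => [xy|xy] /=; last by rewrite oppr0 if_same.
rewrite -xy xv /last_occurrence.
have -> : count_mem x v = 1%N.
  rewrite vE count_cat /= eqxx add1n (count_memPn xt) add0n.
  by rewrite cE in xc; rewrite (count_memPn xc).
rewrite /= (_ : (_ - _)%N = 0%N) ?expr0 //.
by rewrite rev_cons -cats1 index_cat mem_rev (negbTE xt) /= eqxx addn0 size_rev subnn.
Qed.

Lemma surj_diff_sign_new x v p : (p <= size v)%N -> x \notin v ->
  surj_diff_sign R (insert_at p x v) p = 0.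
Proof.
move=> pv xv; rewrite /surj_diff_sign nth_insert_at //.
have xp : x \notin take p v by apply: contra xv; apply: mem_take.
have xd : x \notin drop p v by apply: contra xv; apply: mem_drop.
rewrite /caesura /insert_at drop_size_cat ?size_takel // (negbTE xd).
by rewrite take_size_cat ?size_takel // (negbTE xp).
Qed.

End Signs.

Section FitsInsertion.
Variable n : nat.
Implicit Types (u : seq 'I_n) (w : seq 'S_n) (s : 'S_n).

(** A new value y has to be inserted right before the first term which it
precedes in the permutation of its line, and this place is unique. *)
Lemma sum_fits_insert_at y u w : y \notin u ->
  \sum_(p < (size u).+1) (fits (insert_at p y u) w)%:R = (fits u w)%:R :> R.
Proof.
elim: u w => [|c u IH] w; first by rewrite big_ord1.
rewrite in_cons negb_or => /andP[yc yu].
rewrite big_ord_recl /=.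
under eq_bigr => p _.
  rewrite -/(insert_at p y u) all_insert_at mem_insert_at [c == y]eq_sym (negbTE yc) /=.
  rewrite natr_andb; over.
rewrite -mulr_sumr IH // in_cons (negbTE yc) (negbTE yu) /=.
set s := head _ _; rewrite !natr_andb (precNE s yc) natr_negb.
have [cu|cu] := boolP (all (prec s c) u); last by rewrite !(mul0r, mulr0) add0r.
have [pyc|pyc] := boolP (prec s y c); last by rewrite !(mul0r, mulr0, subr0, mulr1, add0r).
have -> : all (prec s y) u.
  by apply/allP => z /(allP cu); apply: prec_trans.
by rewrite subrr !mul0r addr0 !mul1r.
Qed.

Lemma exists_min s y u : exists2 m, m \in y :: u & all (prec s m) (y :: u).
Proof.
elim: u y => [|z u IH] y; first by exists y; rewrite ?in_cons ?eqxx //= prec_refl.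
have [m mu am] := IH z.
case: (boolP (prec s y m)) => ym.
  exists y; first by rewrite in_cons eqxx.
  rewrite all_cons prec_refl andTb.
  by apply/allP => t /(allP am); apply: prec_trans.
exists m; first by rewrite in_cons mu orbT.
by rewrite all_cons am andbT; have := prec_total s y m; rewrite (negbTE ym).
Qed.

(** There is exactly one least value in y :: u, and it is y if and only
if y precedes u. *)
Lemma sum_other_min s y u :
  \sum_(x : 'I_n) ([&& x != y, x \in y :: u & all (prec s x) (y :: u)])%:R =
  (~~ all (prec s y) u)%:R :> R.
Proof.
have [yu|yu] := boolP (all (prec s y) u).
  rewrite big1 // => x _; case: eqVneq => //= xy.
  case: (boolP (x \in _)) => //= xu; case: (boolP (prec s x y)) => //= pxy.
  case/eqP: xy; apply: (@prec_anti _ s) => //.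
  by move: xu; rewrite in_cons => /predU1P[->|/(allP yu)//]; apply: prec_refl.
have [m mu am] := exists_min s y u.
have my : m != y by apply: contra yu => /eqP <-; case/andP: am.
rewrite (bigD1 m) // big1 => [|x xm]; first by rewrite my mu am /= addr0.
have [//|xy] := eqVneq x y; have [xu|//] := boolP (x \in y :: u).
have [ax|//] := boolP (all (prec s x) (y :: u)); case/eqP: xm.
by apply: (@prec_anti _ s); [apply: (allP ax) | apply: (allP am)].
Qed.

End FitsInsertion.

Section DiffIdentity.
Variable r : nat.
Implicit Types (u : seq 'I_r.+1) (w : seq 'S_r.+1).

(** The coefficient of u in the differential of TR(w), the tables whose
boundary contains u being the insertions of a term x into u at a position p. *)
Definition insertion_sum u w : R :=
  \sum_(p < (size u).+1) \sum_(x : 'I_r.+1)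
    (nondegenerate (insert_at p x u) && fits (insert_at p x u) w)%:R *
      surj_diff_sign R (insert_at p x u) p.

(** Insertions in front of y give (1 - g0) times the coefficient of u for
the remaining permutations.  If y recurs in u, the other insertions are those
into u with opposite sign, except that y itself may not be inserted right after
y.  If y does not recur, they are those into u, together with the insertions of
a second copy of y, which makes the first copy a caesura and has sign -1; here
again the place right after y is excluded. *)
Lemma insertion_sum_cons y u w : nondegenerate (y :: u) ->
  let g0 := (all (prec (head 1%g w) y) u)%:R in
  let g1 := (all (prec (head 1%g (behead w)) y) u)%:R in
  insertion_sum (y :: u) w =
    if y \in u then g1 * (fits u (behead (behead w)))%:R - g0 * insertion_sum u (behead w)
    else (g1 - g0) * (fits u (behead w))%:R + g0 * insertion_sum u w.
Proof.
move=> nyu g0 g1; have nu : nondegenerate u by case/andP: nyu.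
have hd p x : (p <= size u)%N -> y \in insert_at p x u -> (nondegenerate (y :: insert_at p x u)) =
    ~~ ((p == 0%N) && (x == y)) && nondegenerate (insert_at p x u).
  case: p => [|p]; first by rewrite insert_at0 /= eq_sym.
  by case: u nyu {nu g0 g1} => [|z u] //= /andP[-> _] _.
rewrite {1}/insertion_sum big_ord_recl.
rewrite (_ : \sum_x _ = (1 - g0) * (fits (y :: u) (behead w))%:R); last first.
  rewrite -natr_negb -sum_other_min mulr_suml; apply: eq_bigr => x _.
  rewrite insert_at0 surj_diff_sign0 nondegenerate_cons2 nyu andbT.
  rewrite fits_cons.
  case: (x \in _); rewrite ?(mulr0, andbF, mul0r) //= ?mulr1.
  by rewrite -natr_andb -!andbA.
rewrite fits_cons natr_andb -/g1.
rewrite [\sum_(i < _) _](_ : _ = \sum_(p < (size u).+1) \sum_(x : 'I_r.+1)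
  (nondegenerate (y :: insert_at p x u) && fits (y :: insert_at p x u) w)%:R *
      surj_diff_sign R (y :: insert_at p x u) p.+1); last first.
  by apply: eq_bigr => p _; rewrite lift0.
have [yu|yu] := boolP (y \in u).
  rewrite (_ : \sum_(p < _) _ = - g0 * (insertion_sum u (behead w) -
      g1 * (fits u (behead (behead w)))%:R)); first by ring.
  pose T p x := (nondegenerate (insert_at p x u) && fits (insert_at p x u) (behead w))%:R *
        surj_diff_sign R (insert_at p x u) p.
  (* the excluded insertion of y right after y *)
  have -> : g1 * (fits u (behead (behead w)))%:R =
      \sum_(p < (size u).+1) \sum_(x : 'I_r.+1) ((p == 0%N :> nat) && (x == y))%:R * T p x.
    rewrite big_ord_recl (bigD1 y) //= eqxx mul1r big1 => [|x /negbTE ->]; last by rewrite mul0r.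
    rewrite /T insert_at0 surj_diff_sign0 yu mulr1 nyu andTb fits_cons yu natr_andb -/g1 addr0.
    by rewrite big1 ?addr0 // => p _; rewrite big1 // => x _; rewrite mul0r.
  rewrite /insertion_sum -sumrB mulr_sumr; apply: eq_bigr => p _.
  rewrite -sumrB mulr_sumr; apply: eq_bigr => x _; rewrite -/(T p x).
  have pu : (p <= size u)%N by rewrite -ltnS.
  rewrite hd ?mem_insert_at ?yu ?orbT // surj_diff_signS ?size_insert_at //.
  case: (_ && (x == y)); first by rewrite !(mul0r, mul1r) subrr mulr0.
  rewrite andTb mul0r subr0 /T mem_insert_at yu orbT nth_insert_at //.
  rewrite [X in if X then _ else _](_ : _ = false); last first.
    apply/negP => /andP[/eqP ->]; rewrite count_insert_at /= eqxx add1n.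
    by move: yu; rewrite -has_pred1 has_count; set A := count _ _; lia.
  rewrite fits_cons all_insert_at mem_insert_at yu orbT.
  have [xu|xu] := boolP (x \in u); last by rewrite surj_diff_sign_new // oppr0 !mulr0.
  rewrite /g0; case: (boolP (all _ u)) => [yau|]; last by rewrite !(andbF, mul0r, oppr0).
  by rewrite (allP yau x xu) /= mulN1r mulrN.
rewrite [\sum_(p < _) _](_ : _ = - g0 * ((fits u (behead w))%:R
     - g1 * (fits u (behead w))%:R) + g0 * insertion_sum u w); first by ring.
have S0 : \sum_(p < (size u).+1) (p != 0%N :> nat)%:R * (fits (insert_at p y u) (behead w))%:R
    = (fits u (behead w))%:R - g1 * (fits u (behead w))%:R :> R.
  have := sum_fits_insert_at (behead w) yu.
  rewrite big_ord_recl insert_at0 fits_cons (negbTE yu) natr_andb -/g1 => E.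
  rewrite -[X in _ = X - _]E addrAC subrr add0r big_ord_recl mul0r add0r.
  by apply: eq_bigr => p _; rewrite mul1r.
rewrite -S0 /insertion_sum !mulr_sumr -big_split; apply: eq_bigr => p _.
have pu : (p <= size u)%N by rewrite -ltnS.
rewrite (bigD1 y) // [X in _ = _ + g0 * X](bigD1 y) //.
rewrite surj_diff_sign_new // mulr0 [in RHS]/= add0r; congr (_ + _).
  rewrite surj_diff_signS ?size_insert_at // mem_insert_at eqxx nth_insert_at //= eqxx.
  rewrite count_insert_at /= eqxx add1n (count_memPn yu) eqxx.
  have := hd p y pu; rewrite mem_insert_at eqxx => /(_ isT) /= ->.
  rewrite andbT nondegenerate_insert_at // andbT all_insert_at prec_refl /=.
  by rewrite !natr_andb /g0; ring.
rewrite mulr_sumr; apply: eq_bigr => x xy.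
have yi : y \in insert_at p x u = false by rewrite mem_insert_at eq_sym (negbTE xy) (negbTE yu).
have -> : nondegenerate (y :: insert_at p x u) = nondegenerate (insert_at p x u).
  case: (insert_at p x u) yi => // z t; rewrite in_cons => /negbT/norP[yz _].
  by rewrite nondegenerate_cons2 yz.
rewrite surj_diff_signS ?size_insert_at // fits_cons yi.
have [xu|xu] := boolP (x \in u); last by rewrite surj_diff_sign_new // !mulr0.
rewrite all_insert_at.
rewrite /g0; case: (boolP (all _ u)) => [yau|]; last by rewrite !(andbF, mul0r, oppr0).
by rewrite (allP yau x xu) /= mul1r.
Qed.

Lemma delete_at0 (T : Type) (x : T) t : delete_at 0 (x :: t) = t.
Proof. by rewrite /delete_at /= drop0. Qed.

Lemma delete_atS (T : Type) i (x : T) t : delete_at i.+1 (x :: t) = x :: delete_at i t.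
Proof. by []. Qed.

(** The alternating sum satisfies the recursion of [insertion_sum_cons]:
if y does not recur, omitting the first or the second permutation leaves y with
the condition g1 or g0, while if y recurs the first permutation is used by y
alone. *)
Lemma sum_fits_delete u w : nondegenerate u -> size w = (ncaes u).+2 ->
  \sum_(i < size w) (-1) ^+ i * (fits u (delete_at i w))%:R = insertion_sum u w.
Proof.
elim: u w => [|y u IH] w.
  case: w => [|w0 [|w1 [|? ?]]] //= _ _.
  rewrite !big_ord_recl big_ord0 /insertion_sum big_ord1 big1 => [|x _]; last first.
    by rewrite insert_at0 surj_diff_sign0 mulr0.
  by rewrite /= !mulr1 expr1; ring.
move=> nyu sw; rewrite insertion_sum_cons //; have nu : nondegenerate u by case/andP: nyu.
case: w sw => [//|w0 w] sw; rewrite [size _]/= big_ord_recl delete_at0 expr0 mul1r.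
rewrite [head 1%g _]/= [behead _]/=.
have [yu|yu] := boolP (y \in u).
  rewrite -IH //; last by move: sw; rewrite /= yu => -[].
  rewrite fits_cons yu natr_andb; congr (_ + _); rewrite mulr_sumr -sumrN; apply: eq_bigr => i _.
  by rewrite lift0 delete_atS fits_cons yu natr_andb exprS /=; ring.
rewrite -IH //; last by rewrite sw /= (negbTE yu).
rewrite [X in _ = _ + _ * X]big_ord_recl delete_at0 fits_cons (negbTE yu) natr_andb.
rewrite expr0 mul1r mulrDr mulrBl addrA subrK.
congr (_ + _); rewrite mulr_sumr; apply: eq_bigr => i _.
by rewrite lift0 delete_atS fits_cons (negbTE yu) natr_andb mulrCA.
Qed.

End DiffIdentity.
End Insertion.

Section Differential.
Variable R : comPzRingType.

Lemma table_reduction_egen_seq r d (w : seq 'S_r.+1) : size w = d.+1 ->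
  table_reduction (egen R d w) = table_reduction_gen R d w.
Proof. by move=> /eqP sw; apply: (table_reduction_egen R (Tuple sw)). Qed.

(** Replaces a sum over sequences by a sum over the basis; the Boolean
coefficients single out the basis element v, if v is nondegenerate. *)
Lemma sum_basis_eq r d (v : seq 'I_r) (F : seq 'I_r -> R) :
  size v = (r + d)%N -> (forall x, x \in v) ->
  \sum_(t : surj_basis r d) (tval (val t) == v)%:R * F (val t) =
  (nondegenerate v)%:R * F v.
Proof.
move=> /eqP sv fv; have [nv|nv] := boolP (nondegenerate v).
  have Pv : nondegenerate (Tuple sv) && [forall x, x \in Tuple sv].
    by rewrite nv; apply/forallP.
  pose t : surj_basis r d := Sub (Tuple sv) Pv.
  rewrite (bigD1 t) //= eqxx big1 ?addr0 // => s st.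
  rewrite (_ : _ == _ = false) ?mul0r //; apply: contraNF st => /eqP E.
  by apply/eqP/val_inj/val_inj.
rewrite mul0r big1 // => t _; rewrite (_ : _ == _ = false) ?mul0r //.
by apply: contraNF nv => /eqP <-; case/andP: (valP t).
Qed.

(** On the coefficient of u, this is [sum_fits_delete]: the pairs of a table
u' and a position p at which its deletion is u correspond to the insertions
into u. *)
Lemma table_reduction_diff r d (x : BE R r.+1 d.+1) :
  table_reduction (be_diff x) = surj_diff (table_reduction x).
Proof.
rewrite /be_diff {1}/table_reduction lin_ext_comp /surj_diff /table_reduction lin_ext_comp.
apply: eq_lin_ext => t; have sz := size_tuple (val t).
rewrite [LHS]lin_ext_sum.
apply/ffunP => u; rewrite [RHS]lin_ext_coef sum_ffunE.
have su : size (val u) = (r.+1 + d)%N by rewrite size_tuple.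
have /andP[nu /forallP fu] := valP u.
transitivity (\sum_(i < d.+2) (-1) ^+ i * (fits (val u) (delete_at i (val t)))%:R : R).
  apply: eq_bigr => i _; rewrite lin_extZ ffunE; congr (_ * _).
  have sd : size (delete_at i (val t)) = d.+1 by rewrite size_delete_at sz.
  by rewrite -[lin_ext _ _]/(table_reduction _) table_reduction_egen_seq // table_reduction_coef.
have E := @sum_fits_delete R r (val u) (val t) nu.
rewrite sz basis_ncaes in E; rewrite E // /insertion_sum.
transitivity (\sum_(t' : surj_basis r.+1 d.+1) \sum_(p < r.+1 + d.+1)
   (tval (val u) == delete_at p (val t'))%:R *
   ((fits (val t') (val t))%:R * surj_diff_sign R (val t') p)); last first.
  apply: eq_bigr => t' _; rewrite table_reduction_coef // sum_ffunE mulr_sumr.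
  by apply: eq_bigr => p _; rewrite ffunE xgen_coef [RHS]mulrA [RHS]mulrC.
rewrite [RHS]exchange_big su -addnS; apply: eq_bigr => p _.
have pu : (p <= size (val u))%N by rewrite su -ltnS -addnS.
transitivity (\sum_(y : 'I_r.+1) \sum_(t' : surj_basis r.+1 d.+1)
   (tval (val t') == insert_at p y (val u))%:R *
    ((fits (val t') (val t))%:R * surj_diff_sign R (val t') p)).
  apply: eq_bigr => y _.
  rewrite (@sum_basis_eq _ _ _ (fun v => (fits v (val t))%:R * surj_diff_sign R v p)).
  - by rewrite natr_andb mulrA.
  - by rewrite size_insert_at su addnS.
  - by move=> z; rewrite mem_insert_at fu orbT.
rewrite exchange_big; apply: eq_bigr => t' _; rewrite -mulr_suml; congr (_ * _).
have st' : size (val t') = (r.+1 + d.+1)%N by rewrite size_tuple.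
have pt' : (p < size (val t'))%N by rewrite st'.
case: eqVneq => [uE|uE].
  rewrite (bigD1 (nth ord0 (val t') p)) // uE insert_delete_at // eqxx.
  rewrite big1 => [|y yn]; first by rewrite /= addr0.
  rewrite (_ : _ == _ = false) //; apply: contraNF yn => /eqP ->.
  by rewrite nth_insert_at // -uE.
rewrite big1 // => y _; rewrite (_ : _ == _ = false) //.
by apply: contraNF uE => /eqP ->; rewrite delete_insert_at.
Qed.

End Differential.

(** * Composites of permutations *)

Section FlattenIndex.
Local Open Scope nat_scope.

(** Blocks come in the order of s. *)
Lemma index_flatten_diff (T U : eqType) (f : T -> seq U) s (x x' : T) a a' :
  x \in s -> x' \in s -> x != x' -> a \in f x -> a' \in f x' ->
  (forall t, a \in f t -> t = x) -> (forall t, a' \in f t -> t = x') ->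
  (index a (flatten (map f s)) <= index a' (flatten (map f s))) =
  (index x s <= index x' s).
Proof.
move=> xs xs' xx' ax ax' fx fx'; have x'x := xx'; rewrite eq_sym in x'x.
elim: s xs xs' => //= c s IH.
rewrite !in_cons !index_cat [c == x]eq_sym [c == x']eq_sym.
case: (eqVneq x c) => [<- _ _|xc] /=.
  rewrite ax (negbTE x'x) ifF; last by apply: contraNF xx' => /fx' ->.
  by rewrite leq0n (leq_trans _ (leq_addr _ _)) // ltnW // index_mem.
have -> : a \in f c = false by apply: contraNF xc => /fx ->.
case: (eqVneq x' c) => [<- _ _|xc'] /=.
  by rewrite ax' ltn0; apply/negbTE; rewrite -ltnNge ltn_addr // index_mem.
have -> : a' \in f c = false by apply: contraNF xc' => /fx' ->.
by rewrite leq_add2l ltnS => xs xs'; apply: IH.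
Qed.

Lemma index_flatten_same (T U : eqType) (f : T -> seq U) s (x : T) a a' :
  x \in s -> a \in f x -> a' \in f x ->
  (forall t, a \in f t -> t = x) -> (forall t, a' \in f t -> t = x) ->
  (index a (flatten (map f s)) <= index a' (flatten (map f s))) =
  (index a (f x) <= index a' (f x)).
Proof.
move=> xs ax ax' fx fx'; elim: s xs => //= c s IH.
rewrite in_cons !index_cat; case: (eqVneq x c) => [<- _|xc] /=; first by rewrite ax ax'.
have -> : a \in f c = false by apply: contraNF xc => /fx ->.
have -> : a' \in f c = false by apply: contraNF xc => /fx' ->.
by rewrite leq_add2l => xs; apply: IH.
Qed.

End FlattenIndex.

Lemma index_pseq n (w : 'S_n) x : index x (pseq w) = (w^-1%g x : nat).
Proof.
rewrite -{1}[x](permKV w) /pseq index_map; last exact: perm_inj.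
by rewrite index_enum_ord.
Qed.

Section Graft.
Local Open Scope nat_scope.
Variables (r s : nat) (k : 'I_r.+1).
Implicit Types (x : 'I_r.+1) (y : 'I_s.+1) (z : 'I_(r + s).+1).

(** The term of a composite surjection which is read while the ambient
sequence stands at x and the inserted one at y.  Every value of the composite
has this form, with y irrelevant unless x = k. *)
Definition graft x y : 'I_(r + s).+1 :=
  if x == k then shift_in k y else shift_out s k x.

Lemma graft_eq x y x' y' :
  (graft x y == graft x' y') = (x == x') && ((x == k) ==> (y == y')).
Proof.
have oi (a : 'I_r.+1) (b : 'I_s.+1) : a != k -> shift_out s k a == shift_in k b = false.
  move=> ak; apply/eqP => /(congr1 val); rewrite /= shift_outE shift_inE.
  have := ltn_ord b; have : a != k :> nat by [].
  by case: ifP; lia.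
have oo (a b : 'I_r.+1) : a != k -> b != k ->
    (shift_out s k a == shift_out s k b) = (a == b).
  move=> ak bk; apply/eqP/eqP => [/(congr1 val)|-> //]; rewrite /= !shift_outE => E.
  apply: val_inj; move: E; have : a != k :> nat by []; have : b != k :> nat by [].
  by rewrite /=; case: ifP; case: ifP; lia.
rewrite /graft; have [->|xk] := eqVneq x k; have [x'k|xk'] := eqVneq x' k; rewrite ?x'k ?eqxx.
- by rewrite (inj_eq (@shift_in_inj _ _ _)).
- by rewrite [LHS]eq_sym oi // eq_sym (negbTE xk').
- by rewrite oi // (negbTE xk).
- by rewrite oo // implyFb andbT.
Qed.

Lemma graftP z : exists x y, z = graft x y.
Proof.
case: (boolP (k <= z <= k + s)) => [/andP[kz zk]|nz].
  exists k, (inord (z - k)); apply: val_inj; rewrite /graft eqxx /= shift_inE.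
  by rewrite inordK; lia.
have zr := ltn_ord z; have kr := ltn_ord k.
exists (inord (if z < k then z : nat else z - s)), ord0; apply: val_inj.
have V : (if z < k then z : nat else z - s) < r.+1 by move: nz; case: ifP; lia.
rewrite /graft ifF; last first.
  by apply/eqP => /(congr1 val) /=; rewrite inordK //; move: nz; case: ifP; lia.
by rewrite /= shift_outE inordK //; move: nz; do !case: ifP; lia.
Qed.

Lemma graft_neq x y y' : x != k -> graft x y = graft x y'.
Proof. by rewrite /graft => /negbTE ->. Qed.

(** In the sequence of values of the composite permutation, the values of v
occupy the place of k. *)
Lemma prec_graft (u : 'S_r.+1) (v : 'S_s.+1) x y x' y' :
  prec (pcomp u k v) (graft x y) (graft x' y') =
  if (x == k) && (x' == k) then prec v y y' else prec u x x'.
Proof.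
rewrite /prec -!index_pseq pseq_pcomp /pcomp_seq.
set f := fun x0 : 'I_r.+1 => if x0 == k then _ else _.
have fg a b : graft a b \in f a.
  rewrite /f /graft; case: eqP => _; last by rewrite mem_seq1.
  by apply: map_f; apply: mem_pseq.
have fu a b t : graft a b \in f t -> t = a.
  rewrite /f; case: (eqVneq t k) => [->|tk].
    case/mapP => y1 _ E; apply/eqP; have : graft a b == graft k y1 by rewrite E /graft eqxx.
    by rewrite graft_eq eq_sym => /andP[].
  rewrite mem_seq1 => /eqP E; apply/eqP.
  have : graft a b == graft t ord0 by rewrite E /graft (negbTE tk).
  by rewrite graft_eq eq_sym => /andP[].
have [<-|xx'] := eqVneq x x'; last first.
  rewrite ifF; last by apply: contraNF xx' => /andP[/eqP -> /eqP ->].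
  by apply: index_flatten_diff; rewrite ?mem_pseq //; apply: fu.
rewrite andbb; rewrite (index_flatten_same (x := x)) ?mem_pseq //; try exact: fu.
rewrite /f /graft; case: eqP => _; last by rewrite !leqnn.
by rewrite !index_map //; apply: shift_in_inj.
Qed.

End Graft.

(** * Composites of surjections as interleavings *)

Section Interleave.
Local Open Scope nat_scope.
Variables (r s : nat) (k : 'I_r.+1).
Implicit Types (t p : seq bool) (a : seq 'I_r.+1) (b : seq 'I_s.+1).
Implicit Types (z : seq 'I_(r + s).+1).

(** The word t tells at each term whether to advance in a (true) or in b
(false) afterwards. *)
Fixpoint interleave t a b : seq 'I_(r + s).+1 :=
  if t is c :: t' then
    graft k (head ord0 a) (head ord0 b) ::
      (if c then interleave t' (behead a) b else interleave t' a (behead b))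
  else [::].

(** The words which describe a composite surjection: b advances only while
a stands at k, and both sequences are at their last term when the word ends;
the last step, which is always true, only marks the end of a. *)
Fixpoint grafting t a b : bool :=
  match t, a with
  | true :: t', x :: a' =>
    if a' is [::] then (t' == [::]) && (size b == 1) else grafting t' a' b
  | false :: t', x :: _ => [&& x == k, 1 < size b & grafting t' a (behead b)]
  | _, _ => false
  end.

Lemma grafting_nil t a : grafting t a [::] = false.
Proof. by elim: t a => [|[] t IH] [|x [|x' a]] //=; rewrite ?andbF. Qed.

Lemma grafting_ind (P : seq bool -> seq 'I_r.+1 -> seq 'I_s.+1 -> Prop) :
  (forall x y, P [:: true] [:: x] [:: y]) ->
  (forall t x x' a y b, grafting t (x' :: a) (y :: b) -> P t (x' :: a) (y :: b) ->
    P (true :: t) [:: x, x' & a] (y :: b)) ->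
  (forall t a y y' b, grafting t (k :: a) (y' :: b) -> P t (k :: a) (y' :: b) ->
    P (false :: t) (k :: a) [:: y, y' & b]) ->
  forall t a b, grafting t a b -> P t a b.
Proof.
move=> P0 P1 P2; elim=> [|[] t IH] [|x a] b //=.
  case: a => [|x' a].
    by move=> /andP[/eqP -> ]; case: b => [|y []].
  case: b => [|y b] g; last by apply: P1 g (IH _ _ g).
  by rewrite grafting_nil in g.
by case/and3P => /eqP ->; case: b => [|y [|y' b]] // _ g; apply: P2 g (IH _ _ g).
Qed.

Lemma grafting_size1 t a b : grafting t a b -> k \notin a -> size b = 1.
Proof.
move=> g; elim/grafting_ind: t a b / g => // [t x x' a y b _ IH|t a y y' b _ _].
  by rewrite in_cons negb_or => /andP[_ /IH].
by rewrite in_cons eqxx.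
Qed.

(** Past the last occurrence of k the position in b is no longer visible
in the composite. *)
Lemma grafting_replace_last t a b y : grafting t a b -> k \notin a ->
  grafting t a [:: y] /\ interleave t a [:: y] = interleave t a b.
Proof.
move=> g; elim/grafting_ind: t a b / g => [x y0|t x x' a y0 b _ IH|t a y0 y' b _ _].
- by rewrite mem_seq1 eq_sym => xk; rewrite /= (graft_neq _ y0).
- rewrite in_cons negb_or eq_sym => /andP[xk /IH[g E]]; split=> //.
  by move: E => /= ->; rewrite (graft_neq y y0).
- by rewrite in_cons eqxx.
Qed.

(** Every term of a is read, and every term of b is read at some occurrence
of k, provided that k occurs in a. *)
Lemma all_interleave (P : pred 'I_(r + s).+1) t a b : grafting t a b ->
  all P (interleave t a b) = all (fun x => all (fun y => P (graft k x y)) b) a.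
Proof.
move=> g; elim/grafting_ind: t a b / g => [x y|t x x' a y b g|t a y y' b g] /=.
- by rewrite !andbT.
- move=> ->; set A := all _ a; have [xk|xk] := eqVneq x k; last first.
    congr (_ && _); case: (P _) / idP => // Py; rewrite andTb.
    by apply/esym/allP => y1 _; rewrite -(graft_neq y).
  subst x; case: (boolP (k \in x' :: a)) => [ka|/(grafting_size1 g)]; last first.
    by case: b g A => // g A _; rewrite !andbT.
  (* The condition at the first k is part of the one at a later k. *)
  have [->|//] : all (fun y0 => P (graft k k y0)) b \/
      ~~ (P (graft k x' y) && all (fun y0 => P (graft k x' y0)) b && A).
    case: (boolP (all _ b)) => [|nb]; [by left | right].
    apply: contra nb => /andP[/andP[_ B] AA]; apply/allP => y0 y0b.
    move: ka; rewrite in_cons => /predU1P[kx|ka]; first by have := allP B y0 y0b; rewrite -kx.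
    by move/allP: AA => /(_ k ka) /= /andP[_ /allP]; apply.
  - by rewrite andbT.
  - by move/negbTE => ->; rewrite !andbF.
- move=> ->; rewrite -!andbA; case: (boolP (P _)) => //= Py.
  do 2 (congr (_ && _)); apply: eq_in_all => x xa.
  case: (boolP (P (graft k x y))) => //= nPy; case: (eqVneq x k) => [xk|xk].
    by rewrite xk Py in nPy.
  by rewrite -(graft_neq y y') // (negbTE nPy).
Qed.

Lemma mem_interleave t a b x y : grafting t a b ->
  (graft k x y \in interleave t a b) = (x \in a) && ((x == k) ==> (y \in b)).
Proof.
move=> g; have := all_interleave (predC1 (graft k x y)) g.
rewrite all_predC => /(congr1 negb); rewrite negbK has_pred1 => ->.
rewrite -has_predC; have b0 : head y b \in b.
  by elim/grafting_ind: t a b / g => // *; rewrite in_cons eqxx.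
apply/hasP/andP => [[x' xa] /= |[xa /implyP yb]].
  rewrite -has_predC => /hasP[y' yb] /=; rewrite negbK graft_eq => /andP[/eqP <-] xk.
  split=> //; case: eqVneq xk => //= _ /eqP <- //.
exists x => //=; rewrite -has_predC; have [xk|xk] := eqVneq x k.
  by apply/hasP; exists y; rewrite /= ?negbK ?yb ?xk.
by apply/hasP; exists (head y b); rewrite //= negbK (graft_neq _ y).
Qed.

(** The steps of t which are taken at the caesuras of z; for a composite
surjection this is the shuffle of the caesuras of the two factors. *)
Fixpoint caesura_steps t z : seq bool :=
  match t, z with
  | c :: t', x :: z' => if x \in z' then c :: caesura_steps t' z' else caesura_steps t' z'
  | _, _ => [::]
  end.

(** The tuple of composite permutations along the lattice path p. *)
Fixpoint path_perms p (u : seq 'S_r.+1) (v : seq 'S_s.+1) : seq 'S_(r + s).+1 :=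
  pcomp (head 1%g u) k (head 1%g v) ::
    (if p is c :: p' then
       if c then path_perms p' (behead u) v else path_perms p' u (behead v)
     else [::]).

Lemma head_path_perms p u v :
  head 1%g (path_perms p u v) = pcomp (head 1%g u) k (head 1%g v).
Proof. by case: p. Qed.

(** A step in a at x is a caesura of the composite if and only if x recurs
in a, and likewise for b, so the line of the composite is given by the lines of
the two factors.  Comparing two values of the composite amounts to a comparison
in u, or in v if both come from b.  When a run of b stops at y, the comparison
of y with the later terms of b is required a second time at the next occurrence
of k, where y is read again; so it follows from the condition on the rest. *)
Lemma fits_interleave t a b u v : grafting t a b ->
  fits (interleave t a b) (path_perms (caesura_steps t (interleave t a b)) u v) =
  fits a u && fits b v.
Proof.
move=> g; elim/grafting_ind: t a b / g u v => [x y|t x x' a y b g IH|t a y y' b g IH] u v.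
- by [].
- rewrite [interleave _ _ _]/= [caesura_steps _ _]/=
    mem_interleave // [y \in _]in_cons eqxx implybT andbT.
  rewrite fits_cons head_path_perms
    mem_interleave // [y \in _]in_cons eqxx implybT andbT all_interleave //.
  set M := interleave _ _ _; set p := caesura_steps t M.
  have -> : (if x \in x' :: a then behead (path_perms (if x \in x' :: a then true :: p else p) u v)
      else path_perms (if x \in x' :: a then true :: p else p) u v) =
      path_perms p (if x \in x' :: a then behead u else u) v by case: (x \in _).
  rewrite IH [fits [:: x, x' & a] u]fits_cons -[RHS]andbA.
  case: (fits (x' :: a) _); last by rewrite !andbF.
  case: (boolP (fits (y :: b) v)) => fb; last by rewrite !andbF.
  rewrite !andbT; apply: eq_in_all => x1 x1a.
  rewrite (eq_all (a2 := fun y0 => if (x == k) && (x1 == k)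
      then prec (head 1%g v) y y0 else prec (head 1%g u) x x1)); last first.
    by move=> y0; rewrite prec_graft.
  have [/andP[/eqP -> /eqP ->]|_] := boolP ((x == k) && (x1 == k)); last first.
    by rewrite /=; case: (prec _ x x1) => //=; elim: (b).
  rewrite prec_refl; apply/allP => y0; rewrite in_cons => /predU1P[->|]; first exact: prec_refl.
  by move: fb; rewrite fits_cons => /andP[/allP fb _] /fb.
- rewrite [interleave _ _ _]/= [caesura_steps _ _]/=
    mem_interleave // [k \in _]in_cons eqxx implyTb andTb.
  rewrite fits_cons head_path_perms
    mem_interleave // [k \in _]in_cons eqxx implyTb andTb all_interleave //.
  set M := interleave _ _ _; set p := caesura_steps t M.
  have -> : (if y \in y' :: b then behead (path_perms (if y \in y' :: b then false :: p else p) u v)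
      else path_perms (if y \in y' :: b then false :: p else p) u v) =
      path_perms p u (if y \in y' :: b then behead v else v) by case: (y \in _).
  rewrite IH [fits [:: y, y' & b] v]fits_cons.
  rewrite andbCA; case: (boolP (fits (k :: a) u)) => fa //.
  rewrite !andTb; congr (_ && _); rewrite all_cons.
  rewrite (eq_all (a2 := prec (head 1%g v) y)); last by move=> y0; rewrite prec_graft eqxx.
  case: (boolP (all _ (y' :: b))) => // yb; rewrite andTb; apply/allP => x1 x1a.
  apply/allP => y1 y1b; rewrite prec_graft eqxx /=; case: eqVneq => [_|_]; first exact: (allP yb).
  by move: fa; rewrite fits_cons => /andP[/allP fa _]; apply: fa.
Qed.

Lemma ncaes_interleave t a b : grafting t a b ->
  let p := caesura_steps t (interleave t a b) in
  (count id p = ncaes a) * (count negb p = ncaes b) * (size p = ncaes (interleave t a b)).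
Proof.
move=> g; elim/grafting_ind: t a b / g => [x y|t x x' a y b g IH|t a y y' b g IH] //.
- set M := interleave t _ _ in IH; set p := caesura_steps t M in IH.
  have m : graft k x y \in M = (x \in x' :: a).
    by rewrite mem_interleave // [y \in _]in_cons eqxx implybT andbT.
  rewrite [interleave _ _ _]/= -/M [caesura_steps _ _]/= -/p.
  rewrite !(ncaes_cons x) (ncaes_cons (graft _ _ _)) m.
  by case: (x \in _); rewrite /= !IH.
- set M := interleave t _ _ in IH; set p := caesura_steps t M in IH.
  have m : graft k k y \in M = (y \in y' :: b).
    by rewrite mem_interleave // [k \in _]in_cons eqxx implyTb andTb.
  rewrite [interleave _ _ _]/= -/M [caesura_steps _ _]/= -/p.
  rewrite !(ncaes_cons y) (ncaes_cons (graft _ _ _)) m.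
  by case: (y \in _); rewrite /= !IH.
Qed.

(** Since a has no two consecutive terms k, the step following a term is in
b if and only if this term and the next one both come from b. *)
Lemma interleave_inj t a b t' a' b' : grafting t a b -> grafting t' a' b' ->
  nondegenerate a -> nondegenerate a' -> interleave t a b = interleave t' a' b' ->
  [/\ t = t', a = a' & k \in a -> b = b'].
Proof.
move=> g; elim/grafting_ind: t a b / g t' a' b'
  => [x y|t x1 x2 a y b g IH|t a y y' b g IH] t' a' b' g'.
- elim/grafting_ind: t' a' b' / g'
  => [x' y'|t' x' x2' a' y' b' g' _|t' a' y1 y2 b' g' _] _ _ [].
  + move=> /eqP; rewrite graft_eq => /andP[/eqP <- /implyP yy]; split=> //.
    by rewrite mem_seq1 eq_sym => /yy /eqP ->.
  + by move=> _; case: t' g' => // - [].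
  + by move=> _; case: t' g' => // - [].
- elim/grafting_ind: t' a' b' / g'
  => [x' y'|t' x' x2' a' y' b' g' _|t' a' y1 y2 b' g' _] na na' [].
  + by move=> _; case: t g {IH} => // - [].
  + move=> /eqP; rewrite graft_eq => /andP[/eqP xx /implyP yy].
    have na1 : nondegenerate (x2 :: a) by case/andP: na.
    have na1' : nondegenerate (x2' :: a') by case/andP: na'.
    move=> /(IH _ _ _ g' na1 na1') [-> aa bb]; rewrite xx aa; split=> //; rewrite aa in g bb.
    rewrite in_cons => /predU1P[xk|/bb //]; case: (boolP (k \in x2' :: a')) => [/bb //|ka].
    move: (grafting_size1 g ka) (grafting_size1 g' ka); case: (b); case: (b') => // _ _.
    by rewrite xx xk eqxx in yy; rewrite (eqP (yy isT)).
  + move=> /eqP; rewrite graft_eq => /andP[/eqP xk _] E.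
    move: E; case: t g {IH} => [//|c t] g; case: t' g' => [//|c' t'] g' [/eqP].
    rewrite graft_eq => /andP[/eqP x2k _]; by move: na; rewrite /= xk x2k eqxx.
- elim/grafting_ind: t' a' b' / g'
  => [x' y1|t' x' x2' a' y1 b' g' _|t' a' y1 y2 b' g' _] na na' [].
  + by move=> _; case: t g {IH} => // - [].
  + move=> /eqP; rewrite graft_eq => /andP[/eqP xk _] E.
    move: E; case: t g {IH} => [//|c t] g; case: t' g' => [//|c' t'] g' [/eqP].
    rewrite graft_eq => /andP[/eqP x2k _]; by move: na'; rewrite /= -xk -x2k eqxx.
  + move=> /eqP; rewrite graft_eq eqxx => /andP[_ /implyP /(_ isT) /eqP ->].
    move=> /(IH _ _ _ g' na na') [-> -> bb]; split=> //.
    by move=> _; rewrite bb // in_cons eqxx.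
Qed.

End Interleave.

Section GraftingExists.
Local Open Scope nat_scope.
Variables (r s : nat) (k : 'I_r.+1).
Implicit Types (t p : seq bool) (a : seq 'I_r.+1) (b : seq 'I_s.+1).
Implicit Types (z : seq 'I_(r + s).+1).

Lemma grafting_cons t a b : grafting k t a b ->
  exists x a' y b', a = x :: a' /\ b = y :: b'.
Proof.
move=> g; elim/grafting_ind: t a b / g => [x y|t x x' a y b _ _|t a y y' b _ _].
- by exists x, [::], y, [::].
- by exists x, (x' :: a), y, b.
- by exists k, a, y, (y' :: b).
Qed.

Lemma head_interleave t a b : grafting k t a b ->
  exists z', interleave k t a b = graft k (head ord0 a) (head ord0 b) :: z'.
Proof. by case: t => // c t _; eexists. Qed.

(** By induction on z, its tail being already decomposed with a starting
at x1 and b at y1.  Let x and y be given by the first term.  If both x and x1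
are k, then the first step is in b, otherwise it is in a.  A caesura whose step
in p is of the other kind would keep the permutation which compares the first
two terms, so that they would be equal.  The remaining point is that a run of b resumes where the preceding
run stopped: if x = k, x1 <> k and k recurs, then y precedes y1 by the condition
on the first term, while y1 precedes y by the condition on b, as y recurs. *)
Lemma exists_grafting z p u v :
  nondegenerate z -> z != [::] -> size p = ncaes z -> fits z (path_perms k p u v) ->
  exists t a b, [/\ grafting k t a b, z = interleave k t a b, p = caesura_steps t z
    & nondegenerate a && nondegenerate b].
Proof.
elim: z p u v => // c z IH p u v nz _ sp fz.
have nz' : nondegenerate z by case/andP: nz.
have [x [y Ec]] := graftP k c.
have [z0|z0] := eqVneq z [::].
  exists [:: true], [:: x], [:: y]; split=> //; first by rewrite Ec z0.
  by move: sp; rewrite z0 /=; case: (p).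
move: fz; rewrite fits_cons head_path_perms => /andP[/allP cz fz].
have [q [u' [v' [sq Eq pq]]]] : exists q u' v', [/\ size q = ncaes z,
    (if c \in z then behead (path_perms k p u v) else path_perms k p u v) =
    path_perms k q u' v'
  & if c \in z then (p = true :: q /\ u' = behead u /\ v' = v) \/
                    (p = false :: q /\ u' = u /\ v' = behead v)
    else [/\ p = q, u' = u & v' = v]].
  move: sp; rewrite ncaes_cons; case: (c \in z) => /= sp; last by exists p, u, v.
  case: p sp {IH fz cz} => // -[] q [sq]; [exists q, (behead u), v|exists q, u, (behead v)];
  by split; auto.
rewrite Eq in fz; have [t [a [b [g Ez Et /andP[na nb]]]]] := IH q u' v' nz' z0 sq fz.
have [x1 [a1 [y1 [b1 [Ea Eb]]]]] := grafting_cons g.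
have [z1 Ez1] := head_interleave g; rewrite -Ez Ea Eb /= in Ez1.
have cg1 : prec (pcomp (head 1%g u) k (head 1%g v)) c (graft k x1 y1).
  by apply: cz; rewrite Ez1 in_cons eqxx.
have cg : c != graft k x1 y1 by move: nz; rewrite Ez1; case/andP.
have g1min : forall g', g' \in z -> prec (pcomp (head 1%g u') k (head 1%g v')) (graft k x1 y1) g'.
  move=> g' ; move: fz; rewrite Ez1 fits_cons head_path_perms => /andP[/allP fz _].
  by rewrite in_cons => /predU1P[->|/fz //]; apply: prec_refl.
have mz x' y' : (graft k x' y' \in z) = (x' \in a) && ((x' == k) ==> (y' \in b)).
  by rewrite Ez mem_interleave.
(* If the ambient term x recurs, then the ambient permutation has to change
   before x1 is read: otherwise x and x1 would precede each other. *)
have ambient : x \in a -> x != x1 -> u' <> u.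
  move=> xa xx1 Eu; case/eqP: xx1; apply: (@prec_anti _ (head 1%g u)).
    have := cg1; rewrite Ec prec_graft; case: ifP => // /andP[/eqP -> /eqP ->] _.
    exact: prec_refl.
  have [y2 xz] : exists y2, graft k x y2 \in z.
    by exists y1; rewrite mz xa Eb in_cons eqxx implybT.
  have := g1min _ xz; rewrite prec_graft Eu; case: ifP => // /andP[/eqP -> /eqP ->] _.
  exact: prec_refl.
have [xk|xk] := eqVneq x k; last first.
  have xx1 : x != x1 by apply: contra cg => /eqP <-; rewrite Ec (graft_neq y y1).
  exists (true :: t), (x :: a), b; split.
  - by rewrite /= Ea -Ea.
  - by rewrite Ez Ec /= Eb /= (graft_neq y y1).
  - rewrite /= -Et; move: pq; case: ifP => [|_ [//]]; rewrite Ec mz (negbTE xk) andbT => xa.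
    by move=> [[//]|[_ [Eu _]]]; case: (ambient xa xx1).
  - by rewrite nb andbT Ea nondegenerate_cons2 xx1 -Ea.
have [x1k|x1k] := eqVneq x1 k.
  have yy1 : y != y1 by apply: contra cg => /eqP <-; rewrite Ec xk x1k.
  exists (false :: t), a, (y :: b); split.
  - by rewrite /= {1}Ea x1k eqxx Eb /= -Eb.
  - by rewrite Ez Ec /= xk Ea /= x1k -x1k -Ea.
  - rewrite /= -Et; move: pq; case: ifP => [|_ [//]]; rewrite Ec mz xk eqxx /= => /andP[ka yb].
    move=> [[_ [_ Ev]]|[//]]; case/eqP: yy1; apply: (@prec_anti _ (head 1%g v)).
      by have := cg1; rewrite Ec prec_graft xk x1k eqxx.
    have := g1min (graft k k y); rewrite mz ka yb implybT => /(_ isT).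
    by rewrite prec_graft x1k eqxx Ev.
  - by rewrite na Eb nondegenerate_cons2 yy1 -Eb.
have xx1 : x != x1 by rewrite xk eq_sym.
have nka : nondegenerate (x :: a) by rewrite Ea nondegenerate_cons2 xx1 -Ea.
have [ka|ka] := boolP (k \in a); last first.
  have [g' E'] := grafting_replace_last y g ka.
  exists (true :: t), (x :: a), [:: y]; split.
  - by rewrite /= Ea -Ea.
  - by rewrite Ez Ec /= E'.
  - by rewrite /= -Et; move: pq; rewrite Ec mz xk (negbTE ka); case.
  - by rewrite nka.
have xa : x \in a by rewrite xk.
have cin : c \in z.
  by apply: contraT => /negbTE cn; move: pq; rewrite cn => -[_ Eu _]; case: (ambient xa xx1).
move: pq; rewrite cin => -[[Ep [_ Ev]]|[_ [Eu _]]]; last by case: (ambient xa xx1).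
have yb : y \in b by move: cin; rewrite Ec mz xk eqxx => /andP[].
have yE : y = y1.
  apply: (@prec_anti _ (head 1%g v)).
    have := cz (graft k k y1); rewrite mz ka Eb in_cons !eqxx => /(_ isT).
    by rewrite Ec prec_graft xk eqxx.
  move: fz; rewrite Et Ez fits_interleave // => /andP[_].
  move: yb; rewrite Eb in_cons => /predU1P[->|yb]; first by move=> _; apply: prec_refl.
  by rewrite fits_cons Ev => /andP[/allP /(_ _ yb)].
exists (true :: t), (x :: a), b; split.
- by rewrite /= Ea -Ea.
- by rewrite Ez Ec /= Eb /= yE.
- by rewrite /= cin -Et.
- by rewrite nka.
Qed.

End GraftingExists.

(** * Cut points, signs and shuffles *)

Section PathInv.
Local Open Scope nat_scope.

Lemma path_inv_nil : path_inv [::] = 0.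
Proof. by rewrite /path_inv big_ord0. Qed.

Lemma path_inv_cons c p :
  path_inv (c :: p) = (if c then 0 else count id p) + path_inv p.
Proof.
rewrite /path_inv /= big_ord_recl big_ord0 add0n.
transitivity (\sum_(j < size p) ((~~ c && nth false p j : nat) +
  \sum_(i < j) (~~ nth true p i && nth false p j))).
  by apply: eq_bigr => j _; rewrite lift0 big_ord_recl.
rewrite big_split /=; congr (_ + _); case: c; first by rewrite big1.
have -> : count id p = sumn (map nat_of_bool p) by elim: p => //= b p ->.
by rewrite sumnE big_map (big_nth false) big_mkord.
Qed.

Lemma path_inv_run f p : path_inv (nseq f false ++ p) = f * count id p + path_inv p.
Proof.
elim: f => //= f IH; rewrite path_inv_cons IH count_cat count_nseq mul0n add0n.
by rewrite mulSn addnA.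
Qed.

End PathInv.

Section TableLine.
Local Open Scope nat_scope.
Variable T : eqType.
Implicit Type v : seq T.

Lemma table_line0 v : table_line v 0 = 0. Proof. by []. Qed.

Lemma table_line_nil i : table_line ([::] : seq T) i = 0.
Proof. by rewrite /table_line; elim: i {1}(0) => //= i IH m; rewrite IH. Qed.

Lemma table_lineD v i m : table_line v (i + m) = table_line v i + table_line (drop i v) m.
Proof.
elim: i v => [|i IH] [|x v] //; first by rewrite !table_line_nil.
by rewrite addSn !table_line_cons /= IH addnA.
Qed.

Lemma table_line_homo v : {homo table_line v : i j / i <= j}.
Proof. by move=> i j /subnKC <-; rewrite table_lineD leq_addr. Qed.

End TableLine.

Section Substitution.
Local Open Scope nat_scope.
Variables (r s : nat) (k : 'I_r.+1).
Implicit Types (t p : seq bool) (a : seq 'I_r.+1) (b v : seq 'I_s.+1) (j : seq nat).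

(** In front of the (m+1)-st occurrence of k, the sequence v is at position
j_m; it advances to j_(m+1) before the sequence a leaves this occurrence. *)
Fixpoint steps a j : seq bool :=
  if a is x :: a' then
    if x == k then nseq (nth 0 j 1 - nth 0 j 0) false ++ true :: steps a' (behead j)
    else true :: steps a' j
  else [::].

Lemma surj_subst_cons x a v j :
  surj_subst (x :: a) k v j =
  (if x == k then [seq shift_in k y | y <- segment (nth 0 j 0) (nth 0 j 1) v]
   else [:: shift_out s k x]) ++ surj_subst a k v (if x == k then behead j else j).
Proof.
rewrite /surj_subst [iota _ _]/= map_cons [flatten _]/=; congr (_ ++ _).
rewrite -(addn0 1) iotaDl -map_comp; congr flatten; apply: eq_map => p /=.
by case: (x == k); rewrite // ?add1n ?nth_behead.
Qed.

Lemma interleave_run m t a b : m < size b ->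
  interleave k (nseq m false ++ true :: t) (k :: a) b =
  [seq shift_in k y | y <- take m.+1 b] ++ interleave k t a (drop m b).
Proof.
elim: m b => [|m IH] [|y b] //= mb; first by rewrite take0 /= /graft eqxx.
by rewrite /graft eqxx IH.
Qed.

Lemma grafting_run m t a b : m < size b ->
  grafting k (nseq m false ++ t) (k :: a) b = grafting k t (k :: a) (drop m b).
Proof.
elim: m b => [|m IH] [|y b] //= mb; rewrite eqxx ltnS IH //.
by rewrite (leq_ltn_trans (leq0n m) mb).
Qed.

Lemma sorted_last j m : sorted leq j -> m < size j -> nth 0 j m <= last 0 j.
Proof.
move=> sj mj; rewrite -nth_last; case: j sj mj => // j0 j sj mj.
apply: (sorted_leq_nth leq_trans leqnn) => //; by rewrite inE.
Qed.

Lemma surj_subst_interleave a v j :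
  sorted leq j -> size j = (count_mem k a).+1 -> last 0 j < size v ->
  surj_subst a k v j = interleave k (steps a j) a (drop (nth 0 j 0) v).
Proof.
elim: a j => [|x a IH] j //= sj ssj lj; rewrite surj_subst_cons.
have [xk|xk] := eqVneq x k; last first.
  by rewrite IH //; [rewrite /= /graft (negbTE xk) | rewrite ssj (negbTE xk)].
case: j sj ssj lj => [//|j0 [|j1 j]]; rewrite xk eqxx // => /andP[j01 sj] [ssj] lj.
rewrite IH //=; last by rewrite ssj.
rewrite interleave_run /segment; last first.
  rewrite size_drop ltn_sub2r //; [apply: leq_ltn_trans lj | apply: leq_ltn_trans lj].
    by apply: leq_trans j01 _; apply: (@sorted_last (j1 :: j) 0).
  exact: (@sorted_last (j1 :: j) 0).
by rewrite drop_drop subnK.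
Qed.

Lemma grafting_steps a v j : a != [::] ->
  sorted leq j -> size j = (count_mem k a).+1 -> last 0 j = (size v).-1 -> 0 < size v ->
  grafting k (steps a j) a (drop (nth 0 j 0) v).
Proof.
elim: a j => [//|x a IH] j _ sj ssj lj v0.
have [xk|xk] := eqVneq x k; last first.
  rewrite /= (negbTE xk); rewrite /= (negbTE xk) add0n in ssj.
  case: a IH ssj => [_|x' a IH] ssj; last by apply: IH.
  by case: j sj ssj lj => [|j0 []] //= _ _ ->; rewrite size_drop; apply/eqP; lia.
rewrite xk /= eqxx in ssj *; case: j sj ssj lj => [//|j0 [|j1 j]] // /andP[j01 sj] [ssj] lj.
have j1v : j1 < size v.
  have : j1 <= (size v).-1 by rewrite -lj; apply: (@sorted_last (j1 :: j) 0).
  by lia.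
rewrite /= grafting_run; last by rewrite size_drop ltn_sub2r // (leq_ltn_trans j01 j1v).
rewrite drop_drop subnK //=; case: a IH ssj => [_|x' a IH] ssj; last first.
  by apply: (IH (j1 :: j)) => //; rewrite [LHS]/= ssj.
case: j sj ssj lj => //= _ _ ->; rewrite size_drop; apply/eqP; lia.
Qed.

(** The cut points can be read off from the word; j0 is the position of
the head of b in the whole inserted sequence. *)
Lemma exists_steps t a b (j0 : nat) : grafting k t a b ->
  exists j, [/\ steps a (j0 :: j) = t, sorted leq (j0 :: j), size j = count_mem k a
    & (last j0 j).+1 = j0 + size b].
Proof.
move=> g; elim/grafting_ind: t a b / g j0 => [x y|t x x' a y b g IH|t a y y' b g IH] j0.
- have [xk|xk] := eqVneq x k.
    by exists [:: j0]; rewrite /= xk eqxx subnn leqnn addn1.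
  by exists [::]; rewrite /= (negbTE xk) addn1.
- have [j [E sj ssj lj]] := IH j0; have [xk|xk] := eqVneq x k; last first.
    exists j; split=> //; first by rewrite -E [LHS]/= (negbTE xk).
    by rewrite ssj [in RHS]/= (negbTE xk).
  exists (j0 :: j); split=> //; first by rewrite -E [LHS]/= xk eqxx subnn.
    by rewrite /= leqnn.
  by rewrite /= ssj xk eqxx.
- have [j [E sj ssj lj]] := IH j0.+1.
  case: j E sj ssj lj => [|j1 j] /=; rewrite eqxx //= => E /andP[j01 sj] [ssj] lj.
  exists (j1 :: j); split=> //=.
  + have -> : j1 - j0 = (j1 - j0.+1).+1 by lia.
    by rewrite -E.
  + by rewrite (ltnW j01).
  + by rewrite ssj.
  + by rewrite lj addSnnS.
Qed.

Lemma run_inj m m' t t' :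
  nseq m false ++ true :: t = nseq m' false ++ true :: t' -> m = m' /\ t = t'.
Proof.
elim: m m' => [|m IH] [|m'] //= []; [by []|by move=> /IH[-> ->]].
Qed.

Lemma steps_inj a j j' : size j = (count_mem k a).+1 -> size j' = (count_mem k a).+1 ->
  sorted leq j -> sorted leq j' -> nth 0 j 0 = nth 0 j' 0 ->
  steps a j = steps a j' -> j = j'.
Proof.
elim: a j j' => [|x a IH] j j' /=.
  by case: j => [|j0 []] //; case: j' => [|j0' []] //= _ _ _ _ ->.
case: eqVneq => [xk|xk]; last by move=> sj sj' so so' j0 [] /(IH _ _ sj sj' so so' j0).
case: j => [//|j0 [|j1 j]] //; case: j' => [//|j0' [|j1' j']] //=.
move=> [sj] [sj'] /andP[j01 so] /andP[j01' so'] jj /run_inj[E /(IH (j1 :: j) (j1' :: j') _ _ so so')].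
rewrite /= sj sj'; subst j0'; have j11 : j1 = j1' by lia.
by move=> /(_ erefl erefl j11) [-> ->].
Qed.

(** The Koszul exponent is of this form, f b being the number of lines
of the inserted sequence passed before the factor U_(b+1): the factors V_1, ...,
V_b, which this factor is moved across, have total degree the line of j_b. *)
Definition ambient_sum a (f : nat -> nat) :=
  \sum_(b < (count_mem k a).+1)
    f b * (table_line a (nth 0 (occ_bounds a k) b.+1) - table_line a (nth 0 (occ_bounds a k) b)).

Definition occurrences a : seq nat := [seq i <- iota 0 (size a) | nth ord0 a i == k].

Lemma occurrences_cons x a :
  occurrences (x :: a) = nseq (x == k) 0 ++ map S (occurrences a).
Proof.
rewrite /occurrences [size _]/= [iota _ _]/= /=; rewrite -(addn0 1) iotaDl filter_map.
by case: (x == k).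
Qed.

Lemma size_occurrences a : size (occurrences a) = count_mem k a.
Proof. by elim: a => // x a IH; rewrite occurrences_cons size_cat size_nseq size_map IH. Qed.

Lemma ambient_sum1 x f : ambient_sum [:: x] f = 0.
Proof.
rewrite /ambient_sum big1 // => b _; rewrite (_ : nth _ _ b.+1 = 0) ?table_line0 ?muln0 //.
rewrite /occ_bounds -/(occurrences [:: x]) occurrences_cons /=.
by move: (nat_of_ord b) => n; case: (x == k); case: n => [|[|[|]]].
Qed.

Lemma ambient_sum_cons x a f : a != [::] ->
  ambient_sum (x :: a) f =
  (x \in a) * f (x == k : nat) + ambient_sum a (fun i => f ((x == k) + i)).
Proof.
move=> a0; pose l := rcons (occurrences a) (size a).-1.
have sl : size l = (count_mem k a).+1 by rewrite size_rcons size_occurrences.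
have shift n (g : nat -> nat) : n = size l ->
    \sum_(b < n) g b * (table_line (x :: a) (nth 0 (map S l) b) -
        table_line (x :: a) (nth 0 (0 :: map S l) b)) =
    (x \in a) * g 0 +
    \sum_(b < n) g b * (table_line a (nth 0 l b) - table_line a (nth 0 (0 :: l) b)).
  move=> ->; rewrite sl !big_ord_recl /= addnA; congr (_ + _).
    rewrite !table_line0 !subn0 (nth_map 0) ?sl // table_line_cons mulnDr.
    by rewrite [_ * g 0]mulnC.
  apply: eq_bigr => b _; have bl : b.+1 < size l by rewrite sl ltnS ltn_ord.
  by rewrite /bump /= !(nth_map 0) // ?(ltnW bl) // !table_line_cons subnDl.
have E : occ_bounds (x :: a) k = 0 :: nseq (x == k) 0 ++ map S l.
  rewrite /occ_bounds -/(occurrences (x :: a)) occurrences_cons rcons_cat /l map_rcons.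
  by rewrite prednK // lt0n size_eq0.
have E' : occ_bounds a k = 0 :: l by [].
rewrite /ambient_sum E E' /=; case: (x == k) => /=.
  rewrite big_ord_recl table_line0 muln0 add0n.
  by rewrite (shift _ (fun i => f i.+1)) // sl.
by rewrite (shift _ f) // sl.
Qed.

(** For fixed b, the degrees of the factors V_a with a <= b telescope. *)
Lemma surj_koszulE a v j : sorted leq j -> nth 0 j 0 = 0 -> size j = (count_mem k a).+1 ->
  surj_koszul a k v j = ambient_sum a (fun i => table_line v (nth 0 j i)).
Proof.
move=> sj j0 ssj; rewrite /surj_koszul /ambient_sum; apply: eq_bigr => b _.
rewrite -big_distrl /=; congr (_ * _).
have : b < size j by rewrite ssj.
elim: (b : nat) => [|n IH] nj; first by rewrite big_ord0 j0.
rewrite big_ord_recr /= IH ?(ltnW nj) // subnKC //; apply: table_line_homo.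
by apply: (sorted_leq_nth leq_trans leqnn) => //; rewrite inE ?(ltnW nj).
Qed.

Lemma caesura_steps_run m t a b : m < size b ->
  grafting k (true :: t) (k :: a) (drop m b) ->
  let t' := nseq m false ++ true :: t in
  let P := caesura_steps t (interleave k t a (drop m b)) in
  caesura_steps t' (interleave k t' (k :: a) b) =
  nseq (table_line b m) false ++ (if k \in a then true :: P else P).
Proof.
elim: m b => [|m IH] b mb.
  rewrite drop0 table_line0 => g /=; set b' := (X in interleave k t a X).
  rewrite (_ : (_ \in _) = (k \in a)) //.
  case: a g => [/andP[/eqP -> _]|x' a g]; first by [].
  rewrite mem_interleave // eqxx (_ : head ord0 b \in b) ?implybT ?andbT //.
  by case: (b) mb => // *; rewrite in_cons eqxx.
case: b mb => // y b mb /= g.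
have g' : grafting k (nseq m false ++ true :: t) (k :: a) b by rewrite grafting_run.
rewrite mem_interleave // in_cons eqxx /= table_line_cons IH //.
by case: (y \in b).
Qed.

(** A caesura of a placed at or after the b-th occurrence of k, and before
the next one, is counted once for each caesura of v in front of j_b; these are
the inversions of the shuffle of caesuras.  The caesuras in front of the first cut
point, which are not in the interleaving of the tail of v, account for the
last summand. *)
Lemma ambient_sum_path_inv a v j : a != [::] ->
  sorted leq j -> size j = (count_mem k a).+1 -> last 0 j = (size v).-1 -> 0 < size v ->
  let t := steps a j in
  let p := caesura_steps t (interleave k t a (drop (nth 0 j 0) v)) in
  ambient_sum a (fun i => table_line v (nth 0 j i)) =
  path_inv p + table_line v (nth 0 j 0) * count id p.
Proof.
elim: a j => [//|x a IH] j _ sj ssj lj v0 t p.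
have g := @grafting_steps (x :: a) v j isT sj ssj lj v0; rewrite -/t in g.
have [a0|a0] := eqVneq a [::].
  subst a; rewrite ambient_sum1; suff -> : p = nseq (size p) false.
    by rewrite count_nseq -[X in path_inv X]cats0 path_inv_run path_inv_nil !muln0.
  have : count id p = 0.
    by have [[-> _] _] := ncaes_interleave g.
  by elim: (p) => //= -[] q Hq //= /Hq {1}->.
rewrite ambient_sum_cons //.
have [xk|xk] := eqVneq x k; last first.
  have ssj' : size j = (count_mem k a).+1 by rewrite ssj /= (negbTE xk).
  have tE : t = true :: steps a j by rewrite /t /= (negbTE xk).
  rewrite (IH j) //; set q := caesura_steps _ _.
  have -> : p = if x \in a then true :: q else q.
    rewrite /p tE /= mem_interleave; last by apply: grafting_steps.
    by rewrite (negbTE xk) andbT.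
  by case: (x \in a) => //=; rewrite path_inv_cons; ring.
case: j sj ssj lj @t @p g => [|j0 [|j1 j]] /=; rewrite xk eqxx // => /andP[j01 sj] [ssj] lj.
set t := nseq _ _ ++ _ => g; set p := caesura_steps _ _.
have j1v : j1 < size v.
  have : j1 <= (size v).-1 by rewrite -lj; apply: (@sorted_last (j1 :: j) 0).
  by lia.
have mv : j1 - j0 < size (drop j0 v) by rewrite size_drop ltn_sub2r // (leq_ltn_trans j01 j1v).
transitivity ((k \in a) * table_line v j1 +
    ambient_sum a (fun i => table_line v (nth 0 (j1 :: j) i))); first by [].
rewrite (IH (j1 :: j)) //; last by rewrite [LHS]/= ssj.
rewrite [nth 0 (j1 :: j) 0]/=.
rewrite /p /t caesura_steps_run //; last by move: g; rewrite grafting_run.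
rewrite drop_drop subnK //; set q := caesura_steps _ _.
rewrite path_inv_run count_cat count_nseq mul0n add0n.
have -> : table_line v j1 = table_line v j0 + table_line (drop j0 v) (j1 - j0).
  by rewrite -table_lineD subnKC.
by case: (k \in a) => /=; rewrite ?path_inv_cons; ring.
Qed.

End Substitution.

(** * Compatibility with composites *)

Section Composition.
Variable R : comPzRingType.
Variables (r s : nat) (k : 'I_r.+1).

Lemma path_permsE p (u : seq 'S_r.+1) (v : seq 'S_s.+1) :
  [seq pcomp (nth 1%g u (path_x p c)) k (nth 1%g v (path_y p c)) | c <- iota 0 (size p).+1]
  = path_perms k p u v.
Proof.
elim: p u v => [|c p IH] u v; first by rewrite /= !nth0.
have -> : iota 0 (size (c :: p)).+1 = 0%N :: map S (iota 0 (size p).+1) by rewrite -(iotaDl 1).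
rewrite map_cons -map_comp [RHS]/= /path_x /path_y [take 0 _]/= !nth0.
congr (_ :: _); case: c; rewrite -IH.
  by apply: eq_map => i /=; rewrite add1n add0n -!nth_behead.
by apply: eq_map => i /=; rewrite add1n add0n -!nth_behead.
Qed.

Lemma size_path_perms p (u : seq 'S_r.+1) (v : seq 'S_s.+1) :
  size (path_perms k p u v) = (size p).+1.
Proof. by rewrite -path_permsE size_map size_iota. Qed.

Lemma table_reduction_comp_coef d e (u : seq 'S_r.+1) (v : seq 'S_s.+1)
    (z : surj_basis (r + s).+1 (d + e)) :
  table_reduction (be_comp_gen R d e u k v) z =
  \sum_(p : (d + e).-tuple bool | count id p == d)
    (-1) ^+ path_inv p * (fits (val z) (path_perms k p u v))%:R.
Proof.
rewrite /be_comp_gen /table_reduction lin_ext_sum sum_ffunE; apply: eq_bigr => p _.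
rewrite lin_extZ ffunE; congr (_ * _).
have := path_permsE p u v; rewrite size_tuple => ->.
rewrite -[lin_ext _ _]/(table_reduction _) table_reduction_egen_seq; last first.
  by rewrite size_path_perms size_tuple.
by rewrite table_reduction_coef // size_path_perms size_tuple.
Qed.

Lemma basis_neq0 n c (x : surj_basis n.+1 c) : tval (val x) != [::].
Proof. by have := size_tuple (val x); case: (tval _). Qed.

Definition cut_points d e (a : surj_basis r.+1 d) :=
  [pred j : (count_mem k (val a)).+1.-tuple 'I_(s.+1 + e)
    | let j' := map val j in
      [&& sorted leq j', head 0%N j' == 0%N & last 0%N j' == (s + e)%N]].

Section Cut.
Variables (d e : nat) (a : surj_basis r.+1 d) (b : surj_basis s.+1 e).
Variable j : (count_mem k (val a)).+1.-tuple 'I_(s.+1 + e).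
Hypothesis jP : cut_points e a j.
Let jj := map val j.
Let t := steps k (val a) jj.

Lemma cut_facts : [/\ sorted leq jj, size jj = (count_mem k (val a)).+1,
  nth 0 jj 0 = 0%N, last 0%N jj = (size (val b)).-1 & (0 < size (val b))%N].
Proof.
have /and3P[sj hj lj] := jP; split=> //.
- by rewrite size_map size_tuple.
- by rewrite nth0 (eqP hj).
- by rewrite (eqP lj) size_tuple.
- by rewrite size_tuple.
Qed.

Lemma cut_grafting : grafting k t (val a) (val b).
Proof.
have [sj ssj j0 lj v0] := cut_facts.
have := grafting_steps (basis_neq0 a) sj ssj lj v0.
by rewrite j0 drop0.
Qed.

Lemma cut_subst : surj_subst (val a) k (val b) jj = interleave k t (val a) (val b).
Proof.
have [sj ssj j0 lj v0] := cut_facts.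
by rewrite surj_subst_interleave ?j0 ?drop0 // lj; case: (size _) v0.
Qed.

Lemma cut_koszul : surj_koszul (val a) k (val b) jj =
  path_inv (caesura_steps t (interleave k t (val a) (val b))).
Proof.
have [sj ssj j0 lj v0] := cut_facts.
rewrite surj_koszulE // (ambient_sum_path_inv (basis_neq0 a) sj ssj lj v0).
by rewrite j0 drop0 table_line0 mul0n addn0.
Qed.

End Cut.

Lemma nondegenerate_basis n c (x : surj_basis n c) : nondegenerate (val x).
Proof. by case/andP: (valP x). Qed.

Lemma full_basis n c (x : surj_basis n c) y : y \in tval (val x).
Proof. by case/andP: (valP x) => _ /forallP. Qed.

Lemma cut_unique d e (a a' : surj_basis r.+1 d) (b b' : surj_basis s.+1 e) j j' :
  cut_points e a j -> cut_points e a' j' ->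
  surj_subst (val a) k (val b) (map val j) = surj_subst (val a') k (val b') (map val j') ->
  [/\ a = a', b = b' & tval j = tval j' :> seq 'I_(s.+1 + e)].
Proof.
move=> jP jP'; rewrite (cut_subst b jP) (cut_subst b' jP') => E.
have [Et Ea Eb] := interleave_inj (cut_grafting b jP) (cut_grafting b' jP')
  (nondegenerate_basis a) (nondegenerate_basis a') E.
have aa : a = a' by apply/val_inj/val_inj.
have bb : b = b' by apply/val_inj/val_inj/Eb/full_basis.
split=> //; subst a' b'; apply: (inj_map val_inj).
have [sj ssj j0 _ _] := cut_facts b jP; have [sj' ssj' j0' _ _] := cut_facts b jP'.
by apply: (steps_inj ssj ssj' sj sj' _ Et); rewrite j0 j0'.
Qed.

(** A fitting table is a composite of two basis elements; their degrees
are right because their caesuras correspond to the steps of p. *)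
Lemma cut_exists d e (z : surj_basis (r + s).+1 (d + e)) (p : seq bool) u v :
  size p = (d + e)%N -> count id p = d -> fits (val z) (path_perms k p u v) ->
  exists (a : surj_basis r.+1 d) (b : surj_basis s.+1 e) j,
    cut_points e a j /\ tval (val z) = surj_subst (val a) k (val b) (map val j).
Proof.
move=> sp cp fz; have cz := basis_ncaes z.
have [|t [a [b [g Ez Ep /andP[na nb]]]]] :=
  exists_grafting (nondegenerate_basis z) (basis_neq0 z) _ fz; first by rewrite sp.
have ka : k \in a.
  have := full_basis z (graft k k ord0); rewrite Ez mem_interleave // => /andP[//].
have fa x : x \in a.
  by have := full_basis z (graft k x (ord0 : 'I_s.+1)); rewrite Ez mem_interleave // => /andP[].
have fb y : y \in b.
  by have := full_basis z (graft k k y); rewrite Ez mem_interleave // eqxx => /andP[_].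
have [[ca cb] _] := ncaes_interleave g; rewrite -Ez -Ep in ca cb.
have sa : size a == (r.+1 + d)%N by rewrite size_ncaes size_undup_full // -ca cp.
have sb : size b == (s.+1 + e)%N.
  rewrite size_ncaes size_undup_full // -cb; have := count_predC id p.
  by rewrite sp cp => /eqP; rewrite eqn_add2l => /eqP ->.
have Pa : nondegenerate (Tuple sa) && [forall x, x \in Tuple sa].
  by rewrite /= na; apply/forallP.
have Pb : nondegenerate (Tuple sb) && [forall x, x \in Tuple sb].
  by rewrite /= nb; apply/forallP.
pose A : surj_basis r.+1 d := Sub (Tuple sa) Pa.
pose B : surj_basis s.+1 e := Sub (Tuple sb) Pb.
have [j [Et sj ssj lj]] := exists_steps 0 g.
have jlt i : i \in 0%N :: j -> (i < s.+1 + e)%N.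
  move=> ij; rewrite -(eqP sb) -[size b]add0n -lj ltnS.
  have := sorted_last sj (_ : index i (0%N :: j) < _)%N; rewrite index_mem nth_index // => H.
  exact: H.
have sJ : size (map (@inord (s + e)) (0%N :: j)) == (count_mem k (val A)).+1.
  by rewrite size_map /= ssj.
have JE : map val (map (@inord (s + e)) (0%N :: j)) = 0%N :: j.
  rewrite -map_comp -[RHS]map_id; apply/eq_in_map => i /jlt ij /=.
  by rewrite inordK.
exists A, B, (Tuple sJ); rewrite [tval (Tuple _)]/= JE.
have cj : cut_points e A (Tuple sJ).
  suff: [&& sorted leq (map val (Tuple sJ)), head 0%N (map val (Tuple sJ)) == 0%N
    & last 0%N (map val (Tuple sJ)) == (s + e)%N] by [].
  rewrite JE sj /=; apply/eqP; have := lj; rewrite (eqP sb) add0n.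
  exact: succn_inj.
split=> //; have := cut_subst B cj; rewrite [tval (Tuple _)]/= JE => ->.
by rewrite Et Ez.
Qed.

(** At a basis element z both sides have at most one nonzero term.  If z is
the composite of a and b, these terms are indexed by the shuffle of the caesuras
of z and by the cut points of z, and they agree by [fits_interleave] and
[cut_koszul].  Otherwise both sides are zero by [cut_exists]. *)
Lemma table_reduction_comp d e (x : BE R r.+1 d) (y : BE R s.+1 e) :
  table_reduction (be_comp x k y) = surj_comp (table_reduction x) k (table_reduction y).
Proof.
rewrite /be_comp {1}/table_reduction lin_ext_bilin /surj_comp /table_reduction bilin_ext_lin.
apply: eq_bilin_ext => u v; rewrite -[lin_ext _ _]/(table_reduction _).
apply/ffunP => z; rewrite table_reduction_comp_coef.
have su : size (val u) = d.+1 by rewrite size_tuple.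
have sv : size (val v) = e.+1 by rewrite size_tuple.
have -> : bilin_ext (fun (u0 : surj_basis r.+1 d) (v0 : surj_basis s.+1 e) =>
    surj_comp_gen R d e (val u0) k (val v0))
    (table_reduction_gen R d (val u)) (table_reduction_gen R e (val v)) z =
  \sum_(a : surj_basis r.+1 d) \sum_(b : surj_basis s.+1 e)
    \sum_(j | cut_points e a j)
      (tval (val z) == surj_subst (val a) k (val b) (map val j))%:R *
      ((fits (val a) (val u) && fits (val b) (val v))%:R *
       (-1) ^+ surj_koszul (val a) k (val b) (map val j)).
  rewrite /bilin_ext sum_ffunE; apply: eq_bigr => a _.
  rewrite sum_ffunE; apply: eq_bigr => b _.
  rewrite ffunE !table_reduction_coef // -natr_andb /surj_comp_gen sum_ffunE.
  rewrite [LHS]mulr_sumr; apply: eq_bigr => j _.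
  by rewrite ffunE xgen_coef [RHS]mulrC -mulrA.
have [/existsP[a /existsP[b /existsP[j /andP[jP /eqP zE]]]] | nz] := boolP
  [exists a : surj_basis r.+1 d, exists b : surj_basis s.+1 e, exists j,
    cut_points e a j && (tval (val z) == surj_subst (val a) k (val b) (map val j))].
  have g := cut_grafting b jP; set t := steps _ _ _ in g.
  have zM : tval (val z) = interleave k t (val a) (val b) by rewrite zE cut_subst.
  pose p := caesura_steps t (val z).
  have [[cp _] sp] := ncaes_interleave g; rewrite -zM -/p !basis_ncaes in cp sp.
  have spt : size p == (d + e)%N by rewrite sp.
  rewrite (bigD1 (Tuple spt)) /= ?cp // [X in _ + X]big1 => [|q /andP[cq qp]]; last first.
    case: (boolP (fits _ _)) => fz; last by rewrite mulr0.
    case/negP: qp.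
    have [|t' [a' [b' [g' Ez Ep /andP[na nb]]]]] :=
      exists_grafting (nondegenerate_basis z) (basis_neq0 z) _ fz.
      by rewrite size_tuple basis_ncaes.
    have := interleave_inj g g' (nondegenerate_basis a) na; rewrite -zM -Ez => /(_ erefl) [tt _ _].
    by apply/eqP/val_inj; rewrite /= Ep -tt.
  rewrite addr0.
  rewrite (bigD1 a) //= [X in _ = _ + X]big1 => [|a' a'a]; last first.
    rewrite big1 // => b' _; rewrite big1 // => j' jP'; case: eqP => E; last by rewrite mul0r.
    have [aa _ _] := cut_unique jP jP' (etrans (esym zE) E).
    by rewrite aa eqxx in a'a.
  rewrite (bigD1 b) //= [X in _ = _ + X + _]big1 => [|b' b'b]; last first.
    rewrite big1 // => j' jP'; case: eqP => E; last by rewrite mul0r.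
    have [_ bb _] := cut_unique jP jP' (etrans (esym zE) E).
    by rewrite bb eqxx in b'b.
  rewrite (bigD1 j) //= big1 => [|j' /andP[jP' j'j]]; last first.
    case: eqP => E; last by rewrite mul0r.
    have [_ _ jj] := cut_unique jP jP' (etrans (esym zE) E).
    by case/eqP: j'j; apply/val_inj.
  rewrite !addr0 -zE eqxx mul1r mulrC; congr (_ * _).
    by rewrite /p zM fits_interleave.
  by rewrite cut_koszul // -/t -zM.
rewrite big1 => [|p /eqP cp].
  rewrite big1 // => a _; rewrite big1 // => b _; rewrite big1 // => j jP.
  case: eqP => E; last by rewrite mul0r.
  case/negP: nz; apply/existsP; exists a; apply/existsP; exists b; apply/existsP; exists j.
  by rewrite jP E eqxx.
case: (boolP (fits _ _)) => fz; last by rewrite mulr0.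
have [a [b [j [jP zE]]]] := cut_exists (size_tuple p) cp fz.
case/negP: nz; apply/existsP; exists a; apply/existsP; exists b; apply/existsP; exists j.
by rewrite jP zE eqxx.
Qed.

End Composition.

(** * Action, unit and surjectivity *)

Section Action.
Variable R : comPzRingType.

Lemma prec_act n (w s : 'S_n) x y : prec (w * s)%g (s x) (s y) = prec w x y.
Proof. by rewrite /prec invMg !permM !permK. Qed.

Lemma ncaes_map (S T : eqType) (f : S -> T) u : injective f -> ncaes (map f u) = ncaes u.
Proof. by move=> fi; elim: u => //= x u ->; rewrite mem_map. Qed.

Lemma nondegenerate_map (S T : eqType) (f : S -> T) u : injective f ->
  nondegenerate (map f u) = nondegenerate u.
Proof. by move=> fi; elim: u => //= x [|y u] //= ->; rewrite (inj_eq fi). Qed.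

Lemma fits_act n (s : 'S_n) u w : (ncaes u < size w)%N ->
  fits (map s u) [seq (x * s)%g | x <- w] = fits u w.
Proof.
elim: u w => //= x u IH [|w0 w] //= H.
rewrite mem_map; last exact: perm_inj.
rewrite all_map (eq_all (a2 := prec w0 x)); last by move=> y; apply: prec_act.
congr (_ && _); move: H; case: (x \in u) => /= H; first by rewrite IH.
by rewrite -[_ :: map _ _]/(map (fun x => (x * s)%g) (w0 :: w)) IH.
Qed.

Lemma table_reduction_act r d (s : 'S_r.+1) (x : BE R r.+1 d) :
  table_reduction (be_act s x) = surj_act s (table_reduction x).
Proof.
rewrite /be_act {1}/table_reduction lin_ext_comp /surj_act /table_reduction lin_ext_comp.
apply: eq_lin_ext => t; rewrite -[LHS]/(table_reduction _).
have st : size [seq (w * s)%g | w <- val t] = d.+1 by rewrite size_map size_tuple.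
apply/ffunP => u; rewrite table_reduction_egen_seq // table_reduction_coef // lin_ext_coef.
pose v := map s^-1%g (val u).
have uv : tval (val u) = map s v by rewrite /v -map_comp map_id_in // => y _; apply: permKV.
transitivity (\sum_(t' : surj_basis r.+1 d)
    (tval (val t') == v)%:R * (fits (val t') (val t))%:R : R); last first.
  apply: eq_bigr => t' _; rewrite table_reduction_coef ?size_tuple // xgen_coef uv mulrC.
  by rewrite (inj_eq (inj_map (@perm_inj _ s))) eq_sym.
rewrite (sum_basis_eq (fun u0 => (fits u0 (val t))%:R)).
- have /andP[nu _] := valP u; rewrite [tval _]uv nondegenerate_map in nu; last exact: perm_inj.
  rewrite nu mul1r uv fits_act // size_tuple ltnS.
  by have := basis_ncaes u; rewrite [tval _]uv ncaes_map; [move=> -> | apply: perm_inj].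
- by rewrite size_map size_tuple.
- move=> y; apply/mapP; exists (s y); last by rewrite permK.
  by have /andP[_ /forallP] := valP u.
Qed.

Lemma table_reduction_unit :
  table_reduction (egen R 0 [:: (1%g : 'S_1)]) = xgen R 0 [:: ord0].
Proof.
apply/ffunP => u; rewrite table_reduction_egen_seq // table_reduction_coef // xgen_coef.
case: u => [[[|x [|? ?]] //= su] Pu]; by rewrite [x]ord1 eqxx.
Qed.

End Action.

Section ExplicitPreimage.
Local Open Scope nat_scope.
Variable n : nat.
Implicit Types (u l : seq 'I_n) (w : seq 'S_n).

Lemma exists_pseq l : uniq l -> (forall x, x \in l) -> exists w : 'S_n, pseq w = l.
Proof.
move=> ul fl; have sl : size l == n.
  by rewrite -(undup_id ul) size_undup_full.
have inj : injective (tnth (Tuple sl)) by apply/tuple_uniqP.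
exists (perm inj); rewrite /pseq -[RHS](map_tnth_enum (Tuple sl)).
by apply: eq_map => i; rewrite permE.
Qed.

Fixpoint first_occurrences u : seq 'I_n :=
  if u is x :: v then x :: [seq y <- first_occurrences v | y != x] else [::].

Lemma mem_first_occurrences u : first_occurrences u =i u.
Proof.
elim: u => //= x u IH y; rewrite !in_cons mem_filter IH; by case: eqVneq.
Qed.

Lemma uniq_first_occurrences u : uniq (first_occurrences u).
Proof.
by elim: u => //= x u IH; rewrite filter_uniq // mem_filter eqxx.
Qed.

Lemma index_filter_leq (T : eqType) (P : pred T) (l : seq T) a b : P a -> P b ->
  (index a (filter P l) <= index b (filter P l)) = (index a l <= index b l).
Proof.
move=> Pa Pb; elim: l => //= c l IH; have [Pc|Pc] /= := boolP (P c).
  by case: eqP => //; case: eqP => // _ _; rewrite !ltnS.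
rewrite IH ifN; last by apply: contraNneq Pc => ->.
by rewrite ifN //; apply: contraNneq Pc => ->.
Qed.

Lemma prec_index (s : 'S_n) x y : prec s x y = (index x (pseq s) <= index y (pseq s)).
Proof. by rewrite !index_pseq. Qed.

Lemma prec_after (s : 'S_n) l l' x y : pseq s = l ++ x :: l' -> y \notin l -> prec s x y.
Proof.
move=> E yl; have : uniq (pseq s) := pseq_uniq s.
rewrite E -cat_rcons cat_uniq rcons_uniq => /andP[/andP[xl _] _].
rewrite prec_index E !index_cat (negbTE xl) (negbTE yl) leq_add2l /= eqxx.
by [].
Qed.

(** The list l consists of the values which are finished before u starts.
Let x be the first term of u; a table u' fitting w starts with x as well.  If x
recurs in u' but not in u, then x comes right after l in the next permutation,
so that the next line of u' starts with x again.  If x recurs in u but not in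
u', then the permutation added for x orders the other values as the next one
does, and [fits_repeat] applies to the rest of u'. *)
Lemma exists_perms_fitting_only u l :
  nondegenerate u -> uniq l -> (forall x, (x \in u) = (x \notin l)) ->
  exists w, [/\ size w = (ncaes u).+1, forall s, s \in w -> prefix l (pseq s),
    pseq (head 1%g w) = l ++ first_occurrences u, fits u w &
    forall u', nondegenerate u' -> (forall x, (x \in u') = (x \notin l)) ->
      ncaes u' = ncaes u -> fits u' w -> u' = u].
Proof.
elim: u l => [|x v IH] l nu ul T.
  have [s Es] := exists_pseq ul (fun x => negbFE (esym (T x))).
  exists [:: s]; rewrite /= cats0; split=> // [s'|[|x u'] // _ T' _ _].
    by rewrite mem_seq1 => /eqP ->; rewrite Es prefix_refl.
  by have := T' x; rewrite -T in_cons eqxx.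
have nv : nondegenerate v by case/andP: nu.
have xl : x \notin l by rewrite -T in_cons eqxx.
have u'cons u' : (forall y, (y \in u') = (y \notin l)) -> exists x' v', u' = x' :: v'.
  by case: u' => [|x' v'] T'; [move: (T' x); rewrite (negbTE xl) | exists x', v'].
(* A table with values outside l starts with the least one, which is x. *)
have head_eq s l' u' w x' : pseq s = l ++ x :: l' ->
    (forall y, (y \in x' :: u') = (y \notin l)) -> fits (x' :: u') (s :: w) -> x' = x.
  move=> Es T'; rewrite fits_cons => /andP[/allP f _].
  apply: (@prec_anti _ s); last by apply: prec_after Es _; rewrite -T' in_cons eqxx.
  have : x \in x' :: u' by rewrite T' xl.
  by rewrite in_cons => /predU1P[->|/f //]; apply: prec_refl.
have foE : first_occurrences (x :: v) = x :: [seq y <- first_occurrences v | y != x] by [].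
have [xv|xv] := boolP (x \in v); last first.
  have [||w [sw pw hw fw unq]] := IH (rcons l x) nv.
  - by rewrite rcons_uniq xl.
  - move=> y; rewrite mem_rcons in_cons negb_or -T in_cons.
    by case: eqVneq => // ->; rewrite (negbTE xv).
  have hw' : pseq (head 1%g w) = l ++ first_occurrences (x :: v).
    rewrite hw cat_rcons foE; congr (_ ++ _ :: _); apply/esym/all_filterP/allP => y.
    by rewrite mem_first_occurrences => yv; apply: contraNneq xv => <-.
  case: w sw pw hw hw' fw unq => [//|w0 w] sw pw hw hw' fw unq.
  exists (w0 :: w); split=> //.
  - by rewrite sw ncaes_cons (negbTE xv).
  - move=> s /pw /prefixP[l' ->]; rewrite cat_rcons; exact: prefix_prefix.
  - rewrite fits_cons (negbTE xv) fw andbT; apply/allP => y yv.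
    by apply: prec_after hw' _; rewrite -T in_cons yv orbT.
  move=> u' nu' T' cu' fu'; have [x' [v' Eu']] := u'cons _ T'; rewrite {}Eu' in nu' T' cu' fu' *.
  have xx := head_eq _ _ _ _ _ hw' T' fu'; subst x'.
  have nv' : nondegenerate v' by case/andP: nu'.
  move: cu' fu'; rewrite !ncaes_cons fits_cons (negbTE xv).
  have [xv'|xv'] := boolP (x \in v'); last first.
    rewrite !add0n => cu' /andP[_ fv']; rewrite (unq v') // => y.
    rewrite mem_rcons in_cons negb_or -T' in_cons.
    by case: eqVneq => // ->; rewrite (negbTE xv').
  rewrite add0n add1n => cu' /andP[_]; move: sw; rewrite -cu'.
  case: w pw {hw fw unq hw'} => [//|w1 w] pw _.
  case: v' nu' xv' T' {nv' cu'} => [//|y v'] nu' xv' T'.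
  rewrite [behead _]/= fits_cons => /andP[/allP fy _].
  have /prefixP[l' El'] := pw w1 (mem_behead (mem_head w1 w : w1 \in behead (w0 :: w1 :: w))).
  have yx : prec w1 y x.
    by move: xv'; rewrite in_cons => /predU1P[->|/fy //]; apply: prec_refl.
  have xy : prec w1 x y.
    rewrite cat_rcons in El'; apply: prec_after El' _; by rewrite -T' !in_cons eqxx orbT.
  by move: nu'; rewrite nondegenerate_cons2 (prec_anti xy yx) eqxx.
have T1 y : (y \in v) = (y \notin l).
  by rewrite -T in_cons; case: eqVneq => // ->.
have [w [sw pw hw fw unq]] := IH l nv ul T1.
have ul0 : uniq (l ++ first_occurrences (x :: v)).
  rewrite cat_uniq ul uniq_first_occurrences andbT; apply/hasPn => y.
  by rewrite mem_first_occurrences T.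
have fl0 y : y \in l ++ first_occurrences (x :: v).
  by rewrite mem_cat mem_first_occurrences T; case: (y \in l).
have [w0 Ew0] := exists_pseq ul0 fl0.
have Ew0' := Ew0; rewrite foE in Ew0'.
exists (w0 :: w); split=> //.
- by rewrite /= sw xv.
- move=> s; rewrite in_cons => /predU1P[->|/pw //]; rewrite Ew0; exact: prefix_prefix.
- rewrite fits_cons xv fw andbT; apply/allP => y yv.
  by apply: prec_after Ew0' _; rewrite -T in_cons yv orbT.
move=> u' nu' T' cu' fu'; have [x' [v' Eu']] := u'cons _ T'; rewrite {}Eu' in nu' T' cu' fu' *.
have xx := head_eq _ _ _ _ _ Ew0' T' fu'; subst x'.
have nv' : nondegenerate v' by case/andP: nu'.
move: cu' fu'; rewrite !ncaes_cons fits_cons xv.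
have [xv'|xv'] := boolP (x \in v').
  move=> /addnI cu' /andP[_ fv']; rewrite (unq v') // => y.
  by rewrite -T' in_cons; case: eqVneq => // ->.
rewrite add0n add1n => cu' /andP[_]; case: w sw {pw fw unq} hw => [//|w1 w] _ hw fv'.
suff: ~~ nondegenerate v' by rewrite nv'.
apply: (fits_repeat fv'); last by rewrite cu'.
have out a : a \in v' -> (a \notin l) && (a != x).
  move=> av; rewrite -T' in_cons av orbT; by apply: contraNneq xv' => <-.
move=> a b /out /andP[al ax] /out /andP[bl bx].
rewrite !prec_index Ew0' hw !index_cat (negbTE al) (negbTE bl) !leq_add2l /=.
by rewrite eq_sym (negbTE ax) eq_sym (negbTE bx) ltnS (@index_filter_leq _ (predC1 x)).
Qed.

End ExplicitPreimage.

Section Surjectivity.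
Variable R : comPzRingType.

Lemma table_reduction_basis r d (u : surj_basis r.+1 d) :
  exists x : BE R r.+1 d, table_reduction x = xgen R d (val u).
Proof.
have /andP[nu /forallP fu] := valP u.
have [|w [sw _ _ fw unq]] := exists_perms_fitting_only nu (isT : uniq [::]).
  by move=> x; rewrite fu.
rewrite basis_ncaes in sw.
exists (egen R d w); rewrite table_reduction_egen_seq //; apply/ffunP => u'.
rewrite table_reduction_coef // xgen_coef; congr (nat_of_bool _)%:R.
apply/idP/eqP => [fu'|->//]; have /andP[nu' /forallP fu''] := valP u'.
by apply: unq; rewrite ?basis_ncaes // => x; rewrite fu''.
Qed.

Lemma table_reduction_surj r d (y : Surj R r.+1 d) :
  exists x : BE R r.+1 d, table_reduction x = y.
Proof.
have [f fP] := fin_all_exists (@table_reduction_basis r d).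
exists (lin_ext f y); rewrite /table_reduction lin_ext_comp [RHS]freemod_delta.
by apply: eq_lin_ext => u; rewrite -[LHS]/(table_reduction _) fP xgen_basis.
Qed.

End Surjectivity.

(** * Filtrations *)

Section Variations.
Local Open Scope nat_scope.

Lemma variations_cons2 (T : eqType) (x y : T) l :
  variations [:: x, y & l] = (x != y) + variations (y :: l).
Proof. by []. Qed.

Lemma variations_cons (T : eqType) (x : T) l : variations l <= variations (x :: l).
Proof. by case: l => // y l; rewrite variations_cons2 leq_addl. Qed.

Lemma variations_del (T : eqType) (x y : T) l :
  variations (x :: l) <= variations [:: x, y & l].
Proof.
case: l => [|z l]; rewrite !variations_cons2 // addnA leq_add2r.
by case: (eqVneq x z) => //= xz; case: (eqVneq x y) => [<-|//]; rewrite xz.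
Qed.

Lemma variations_size (T : eqType) (l : seq T) : variations l <= (size l).-1.
Proof.
elim: l => // x [|y l] // IH; rewrite variations_cons2.
by rewrite (leq_add (leq_b1 _) IH).
Qed.

Variable n : nat.
Implicit Types (u : seq 'I_n) (w : seq 'S_n).

Definition restrict (i j : 'I_n) u := [seq x <- u | (x == i) || (x == j)].

Definition orders (i j : 'I_n) w := [seq (index i (pseq x) < index j (pseq x)) | x <- w].

Lemma orders_cons (i j : 'I_n) (s : 'S_n) w :
  orders i j (s :: w) = (index i (pseq s) < index j (pseq s)) :: orders i j w.
Proof. by []. Qed.

(** Let a variation start at the term c of u.  The permutation of its line
orders c before the other letter, whereas the entry put in front of the orders
given by w is the opposite one; so the variation of u is matched by a change of
order. *)
Lemma fits_variations (i j : 'I_n) u w : i != j -> ncaes u < size w -> fits u w ->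
  forall c l, restrict i j u = c :: l ->
  variations (c :: l) <= variations ((c != i) :: orders i j w).
Proof.
move=> ij; elim: u w => [//|x u IH] [//|w0 w] sw; rewrite fits_cons => /andP[/allP xu fu] c l.
rewrite ncaes_cons ltnS in sw; set w' := (if x \in u then _ else _) in fu.
have sw' : ncaes u < size w' by move: sw; rewrite /w'; case: (x \in u).
have dw' b : variations (b :: orders i j w') <= variations (b :: orders i j (w0 :: w)).
  by rewrite /w'; case: (x \in u) => //=; apply: variations_del.
rewrite /restrict /= -/(restrict i j u); case: ifP => xij; last first.
  by move=> /(IH _ sw' fu)/leq_trans; apply.
move=> [<-] {c l}<-.
case E : (restrict i j u) => [|c l]; first by rewrite leq0n.
have IHc := IH _ sw' fu _ _ E; rewrite variations_cons2.
have [xc|xc] /= := eqVneq x c; first by rewrite xc; apply: leq_trans IHc (dw' _).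
have cR : c \in restrict i j u by rewrite E in_cons eqxx.
move: cR; rewrite mem_filter => /andP[cij cu].
have o0 : (index i (pseq w0) < index j (pseq w0)) = (x == i).
  have xc0 : prec w0 x c := xu c cu.
  have cx0 : prec w0 c x = false by rewrite (precNE w0 xc) xc0.
  rewrite !prec_index in xc0 cx0.
  move: xij cij xc xc0 cx0; have [-> _|xi] /= := eqVneq x i.
    case: eqVneq => [-> _|_ /eqP ->] //=; rewrite ?eqxx // ltn_neqAle => _ ->.
    by case: eqP => // ->; rewrite leqnn.
  move=> /eqP ->; case: (eqVneq c i) => [-> _ _ ji|_ /= /eqP ->]; last by rewrite eqxx.
  by move=> ij'; rewrite ltnNge ji.
have ci : (c != i) = (x == i).
  move: xij cij xc; case: (eqVneq x i) => [->|xi] /=; first by rewrite eq_sym => _ _ ->.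
  by move=> /eqP ->; case: eqVneq => //= _ /eqP ->; rewrite eqxx.
rewrite o0 variations_cons2.
have -> : ((x != i) != (x == i)) = true by case: (x == i).
rewrite leq_add2l; apply: leq_trans IHc _; rewrite ci /w'; case: (x \in u) => //.
by rewrite orders_cons o0 variations_cons2 eqxx add0n.
Qed.

Lemma fits_filt m u w : 0 < m -> ncaes u < size w -> fits u w ->
  be_filt_cond m w -> surj_filt_cond m u.
Proof.
move=> m0 sw fu /forallP wm; apply/forallP => i; apply/forallP => j; apply/implyP => ij.
have ijn : i != j by apply: contraTneq ij => ->; rewrite ltnn.
have := implyP (forallP (wm i) j) ij; rewrite -/(orders i j w) -/(restrict i j u) => om.
case E : (restrict i j u) => [//|c l].
apply: leq_trans (fits_variations ijn sw fu E) _; rewrite -(prednK m0).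
move: om; case: (orders i j w) => [//|o ol] om.
by rewrite variations_cons2 (leq_add (leq_b1 _) om).
Qed.

(** For a caesura x and the term y which follows it, the subsequence on x
and y contains x, y, x. *)
Lemma caesura_not_surj_filt1 u : 0 < ncaes u -> nondegenerate u -> ~~ surj_filt_cond 1 u.
Proof.
move=> cu nu; suff [x [y [xy V]]] : exists x y, x != y /\ 1 < variations (restrict x y u).
  apply/negP => /forallP F; have sym : restrict y x u = restrict x y u.
    by apply: eq_filter => z; rewrite orbC.
  have : x != y :> nat by []. 
  rewrite neq_ltn => /orP[] H.
    by have := implyP (forallP (F x) y) H; rewrite -/(restrict x y u) leqNgt V.
  by have := implyP (forallP (F y) x) H; rewrite -/(restrict y x u) sym leqNgt V.
elim: u cu nu => // x u IH; rewrite ncaes_cons; have [xu _ nu|xu] := boolP (x \in u); last first.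
  move=> cu /= /andP[_ nu]; have [a [b [ab V]]] := IH cu nu; exists a, b; split=> //.
  rewrite /restrict /=; case: ifP => // _; exact: leq_trans V (variations_cons _ _).
case: u xu nu {IH} => // y u xu /= /andP[xy _]; exists x, y; split=> //.
rewrite /restrict /= !eqxx orbT /= variations_cons2 xy ltnS.
have xr : x \in restrict x y u.
  by move: xu; rewrite in_cons (negbTE xy) mem_filter eqxx.
rewrite -/(restrict x y u); elim: (restrict x y u) xr => //= z l IH.
rewrite in_cons variations_cons2 => /predU1P[<-|/IH H]; first by rewrite eq_sym xy.
case: (eqVneq y z) => //= yz; rewrite add0n -yz; exact: H.
Qed.

Lemma uniq_surj_filt m u : 0 < m -> uniq u -> surj_filt_cond m u.
Proof.
move=> m0 uu; apply/forallP => i; apply/forallP => j; apply/implyP => _.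
apply: leq_trans (variations_size _) _; rewrite -/(restrict i j u).
apply: leq_trans m0; suff : size (restrict i j u) <= 2 by case: (size _).
rewrite size_filter; have := count_predUI (pred1 i) (pred1 j) u.
rewrite !count_uniq_mem // => E.
apply: leq_trans (leq_addr (count (predI (pred1 i) (pred1 j)) u) _) _.
rewrite [X in X <= _]E; exact: leq_add (leq_b1 _) (leq_b1 _).
Qed.

Lemma pseq_inj : injective (@pseq n).
Proof.
move=> s s' E; apply: invg_inj; apply/permP => x; apply: val_inj.
by rewrite /= -!index_pseq E.
Qed.

Lemma prec_inj (s s' : 'S_n) : prec s =2 prec s' -> s = s'.
Proof.
move=> E; apply: pseq_inj; apply: (sorted_eq (@prec_trans _ s)).
- by move=> x y /andP[xy yx]; apply: prec_anti xy yx.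
- exact: sorted_pseq.
- have := sorted_pseq s'; rewrite /sorted; case: (pseq s') => // x l.
  by rewrite (eq_path E).
- by apply: uniq_perm; rewrite ?pseq_uniq // => x; rewrite !mem_pseq.
Qed.

(** Two permutations which order all pairs i < j in the same way are equal. *)
Lemma nondegenerate_not_be_filt1 w : 1 < size w -> nondegenerate w -> ~~ be_filt_cond 1 w.
Proof.
case: w => [//|s0 [//|s1 w]] _ /= /andP[s01 _]; apply: contra s01 => /forallP F.
have H (i j : 'I_n) : i < j -> prec s0 j i = prec s1 j i.
  move=> ij; have := implyP (forallP (F i) j) ij.
  rewrite leqn0 /= variations_cons2 addn_eq0 eqb0 negbK => /andP[/eqP E _].
  by rewrite !prec_index leqNgt E -leqNgt.
apply/eqP/prec_inj => i j; case: (ltngtP i j) => [ij|ji|/val_inj ->]; last by rewrite !prec_refl.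
- have ijn : j != i by apply: contraTneq ij => ->; rewrite ltnn.
  by rewrite !(precNE _ ijn) H.
- exact: H.
Qed.

Lemma fits_uniq u (s : 'S_n) : uniq u -> fits u [:: s] = sorted (prec s) u.
Proof.
rewrite sorted_pairwise; last exact: prec_trans.
by elim: u => //= x u IH /andP[xu uu]; rewrite (negbTE xu) IH.
Qed.

Lemma fits_perm u (s : 'S_n) : uniq u -> (forall x, x \in u) ->
  fits u [:: s] = (u == pseq s).
Proof.
move=> uu fu; rewrite fits_uniq //; apply/idP/eqP => [su|->]; last exact: sorted_pseq.
apply: (sorted_eq (@prec_trans _ s)) su (sorted_pseq s) _.
- by move=> x y /andP[xy yx]; apply: prec_anti xy yx.
- by apply: uniq_perm; rewrite ?pseq_uniq // => x; rewrite fu mem_pseq.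
Qed.

End Variations.

Section Filtration.
Variable R : comPzRingType.

(** Membership in the span of a part of a basis is tested on coordinates;
the elements g t with t outside Q are zero. *)
Lemma in_spanP (T : finType) (Q P : pred T) (g : T -> freemod R {t | Q t}) x :
  (forall t s, g t s = (val s == t)%:R) ->
  in_span P g x <-> (forall s, ~~ P (val s) -> x s = 0).
Proof.
move=> gE; split=> [[c ->] s nPs|H].
  rewrite sum_ffunE big1 // => t Pt; rewrite ffunE gE; case: eqP => [E|_]; last exact: mulr0.
  by rewrite E Pt in nPs.
exists (fun t => \sum_s (val s == t)%:R * (x s : R)).
apply/ffunP => s; rewrite sum_ffunE.
have F t : ((\sum_s0 (val s0 == t)%:R * (x s0 : R)) *: g t) s = (val s == t)%:R * (x s : R).
  rewrite ffunE gE [LHS]mulrC; have [E|nE] := eqVneq (val s) t; last by rewrite !mul0r.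
  rewrite !mul1r (bigD1 s) //= E eqxx mul1r big1 ?addr0 // => s' s's.
  by rewrite -E (inj_eq val_inj) (negbTE s's) mul0r.
under eq_bigr do rewrite F.
have [c|c] := boolP (P (val s)); last first.
  rewrite H // big1 // => t _; exact: mulr0.
rewrite (bigD1 (val s)) //= eqxx mul1r big1 ?addr0 // => t /andP[_ /negbTE ts].
by rewrite eq_sym ts mul0r.
Qed.

Lemma surj_filtP m r d (y : Surj R r d) :
  surj_filt m y <->
  (forall t : surj_basis r d, ~~ surj_filt_cond m (val t) -> y t = 0).
Proof. by apply: in_spanP => u t; rewrite xgen_coef. Qed.

Lemma be_filtP m r d (x : BE R r d) :
  be_filt m x <->
  (forall t : be_basis r d, ~~ be_filt_cond m (val t) -> x t = 0).
Proof. by apply: in_spanP => w t; rewrite egen_coef. Qed.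

Lemma table_reduction_filt m r d (x : BE R r.+1 d) : (0 < m)%N ->
  be_filt m x -> surj_filt m (table_reduction x).
Proof.
move=> m0 /be_filtP fx; apply/surj_filtP => u nu; rewrite lin_ext_coef big1 // => t _.
rewrite table_reduction_coef ?size_tuple //; case: (boolP (fits _ _)) => fu; last by rewrite mulr0.
rewrite fx ?mul0r //; apply: contra nu => ct.
by apply: fits_filt fu ct; rewrite // basis_ncaes size_tuple.
Qed.

End Filtration.

(** * The associative operad *)

Section Associative.
Variable R : comPzRingType.

Lemma assoc_pos r d (x : Assoc R r d.+1) : x = 0.
Proof. by apply/ffunP => -[]. Qed.

(** The proof H is a variable because it is a component of the basis
element. *)
Lemma agen_delta r (w : 'S_r) (H : 0 == 0 :> nat) :
  agen R 0 w = [ffun t => (t == exist _ w H)%:R].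
Proof. by apply/ffunP => t; rewrite !ffunE. Qed.

Lemma lin_ext_agen (M : lmodType R) r (g : assoc_basis r 0 -> M) (w : 'S_r) (H : 0 == 0 :> nat) :
  lin_ext g (agen R 0 w) = g (exist _ w H).
Proof. by rewrite (agen_delta w H) lin_ext_delta. Qed.

Lemma assoc_to_be_agen r (w : 'S_r) : assoc_to_be (agen R 0 w) = egen R 0 [:: w].
Proof. exact: lin_ext_agen. Qed.

Definition be_basis0 r (w : 'S_r) : be_basis r 0 :=
  exist (fun t : 1.-tuple 'S_r => nondegenerate t) [tuple w] isT.

Lemma egen0_delta r (w : 'S_r) : egen R 0 [:: w] = [ffun t => (t == be_basis0 w)%:R].
Proof. by rewrite -[[:: w]]/(tval (val (be_basis0 w))) egen_basis. Qed.

Lemma bilin_ext_delta (S T : finType) (M : lmodType R) (h : S -> T -> M) s t :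
  bilin_ext h [ffun s' => (s' == s)%:R] [ffun t' => (t' == t)%:R] = h s t.
Proof.
rewrite /bilin_ext (bigD1 s) //= [X in _ + X]big1 => [|s' /negbTE ss]; last first.
  by rewrite big1 // => t' _; rewrite !ffunE ss mul0r scale0r.
rewrite addr0 (bigD1 t) //= big1 => [|t' /negbTE tt]; last first.
  by rewrite !ffunE tt mulr0 scale0r.
by rewrite addr0 !ffunE !eqxx mulr1 scale1r.
Qed.

Lemma be_comp0 r s (u : 'S_r.+1) k (v : 'S_s.+1) :
  be_comp (egen R 0 [:: u]) k (egen R 0 [:: v]) = egen R (0 + 0) [:: pcomp u k v].
Proof.
rewrite !egen0_delta /be_comp bilin_ext_delta /be_comp_gen (bigD1 [tuple]) //=.
rewrite [X in _ + X]big1 => [|p /andP[_ /eqP[]]]; last exact: tuple0.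
by rewrite path_inv_nil scale1r addr0.
Qed.

Lemma assoc_to_be_morphism :
  dg_operad_morphism (O := assoc_operad R) (P := barratt_eccles R) (@assoc_to_be R).
Proof.
split=> [r d|r d x|r d s x||r s d e x k y] /=.
- exact: lin_ext_linear.
- by rewrite (assoc_pos x) /assoc_to_be !lin_ext0 /be_diff lin_ext0.
- case: d x => [|d] x; last by rewrite (assoc_pos x) /assoc_act /assoc_to_be /be_act !lin_ext0.
  rewrite /assoc_act {1}/assoc_to_be lin_ext_comp /assoc_to_be /be_act lin_ext_comp.
  apply: eq_lin_ext => t; rewrite -[lin_ext _ (agen _ _ _)]/(assoc_to_be _) assoc_to_be_agen.
  by rewrite [in RHS]egen0_delta lin_ext_delta.
- exact: assoc_to_be_agen.
case: d x => [|d] x; last first.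
  rewrite (assoc_pos x) /assoc_comp /assoc_to_be lin_ext0 /be_comp /bilin_ext.
  rewrite [X in lin_ext _ X]big1 ?lin_ext0 ?[RHS]big1 // => t _;
  by rewrite big1 // => t' _; rewrite ffunE mul0r scale0r.
case: e y => [|e] y; last first.
  rewrite (assoc_pos y) /assoc_comp /assoc_to_be lin_ext0 /be_comp /bilin_ext.
  rewrite [X in lin_ext _ X]big1 ?lin_ext0 ?[RHS]big1 // => t _;
  by rewrite big1 // => t' _; rewrite ffunE mulr0 scale0r.
rewrite /assoc_comp {1}/assoc_to_be lin_ext_bilin /be_comp /assoc_to_be bilin_ext_lin.
apply: eq_bilin_ext => u v; rewrite -[LHS]/(assoc_to_be _) assoc_to_be_agen.
by rewrite -be_comp0.
Qed.

Lemma table_reduction_assoc r d (a : Assoc R r.+1 d) :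
  table_reduction (assoc_to_be a) = assoc_to_surj a.
Proof.
case: d a => [|d] a.
  rewrite /assoc_to_be /table_reduction lin_ext_comp; apply: eq_lin_ext => t.
  rewrite -[LHS]/(table_reduction _) table_reduction_egen_seq //; apply/ffunP => u.
  rewrite table_reduction_coef // xgen_coef fits_perm //; last exact: full_basis.
  by rewrite uniq_ncaes basis_ncaes.
by rewrite (assoc_pos a) /assoc_to_be /assoc_to_surj /table_reduction !lin_ext0.
Qed.

(** By [table_reduction_assoc] this is the composite of two morphisms. *)
Lemma assoc_to_surj_morphism :
  dg_operad_morphism (O := assoc_operad R) (P := surjection_operad R) (@assoc_to_surj R).
Proof.
have [Bl Bd Ba Bu Bc] := assoc_to_be_morphism.
split=> [r d|r d x|r d s x||r s d e x k y] /=; first exact: lin_ext_linear.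
all: rewrite -!table_reduction_assoc.
- by have /= -> := Bd r d x; apply: table_reduction_diff.
- by have /= -> := Ba r d s x; apply: table_reduction_act.
- by have /= -> := Bu; apply: table_reduction_unit.
- by have /= -> := Bc r s d e x k y; apply: table_reduction_comp.
Qed.

Lemma assoc_to_surj_inj r d : injective (@assoc_to_surj R r.+1 d).
Proof.
case: d => [|d] a a' E; last by rewrite (assoc_pos a) (assoc_pos a').
have coef (b : Assoc R r.+1 0) (t : assoc_basis r.+1 0) :
    b t = \sum_(t' : assoc_basis r.+1 0) (b t' : R) * (pseq (val t) == pseq (val t'))%:R.
  rewrite (bigD1 t) // (eqxx (pseq _)) mulr1 big1 => [|t' tt]; first by rewrite [RHS]addr0.
  rewrite (inj_eq (@pseq_inj _)) (inj_eq val_inj) eq_sym (negbTE tt).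
  exact: mulr0.
apply/ffunP => t.
have P : nondegenerate (pseq (val t)) && [forall x, x \in pseq (val t)].
  apply/andP; split; last by apply/forallP => x; apply: mem_pseq.
  have := pseq_uniq (val t); elim: (pseq _) => //= x [|y l] //= IH.
  by rewrite in_cons negb_or => /andP[/andP[-> _]] /IH.
have S : size (pseq (val t)) == (r.+1 + 0)%N by rewrite size_pseq addn0.
pose u : surj_basis r.+1 0 := exist _ (Tuple S) P.
have := congr1 (fun y : Surj R r.+1 0 => y u) E.
rewrite /assoc_to_surj !lin_ext_coef [LHS](eq_bigr (fun t' => (a t' : R) *
  (pseq (val t) == pseq (val t'))%:R)) => [|t' _]; last by rewrite xgen_coef.
rewrite [RHS](eq_bigr (fun t' => (a' t' : R) *
  (pseq (val t) == pseq (val t'))%:R)) => [|t' _]; last by rewrite xgen_coef.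
by rewrite -!coef.
Qed.

Lemma assoc_to_be_inj r d : injective (@assoc_to_be R r.+1 d).
Proof.
move=> a a' E; apply: assoc_to_surj_inj.
by rewrite -!table_reduction_assoc E.
Qed.

Lemma assoc_to_be_surj r (x : BE R r.+1 0) : exists a, assoc_to_be a = x.
Proof.
exists (lin_ext (fun t : be_basis r.+1 0 => agen R 0 (head 1%g (val t))) x).
rewrite [RHS]freemod_delta /assoc_to_be lin_ext_comp; apply: eq_lin_ext => t.
rewrite -[LHS]/(assoc_to_be _) assoc_to_be_agen -egen_basis; congr egen.
by case: t => -[[|w []]].
Qed.

Lemma be_filt1_image r d (x : BE R r.+1 d) :
  be_filt 1 x <-> exists a : Assoc R r.+1 d, assoc_to_be a = x.
Proof.
case: d x => [|d] x.
  split=> _; first exact: assoc_to_be_surj.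
  apply/be_filtP => t /negP[]; apply/forallP => i; apply/forallP => j; apply/implyP => _.
  by apply: leq_trans (variations_size _) _; rewrite size_map size_tuple.
split=> [/be_filtP fx|[a <-]].
  exists 0; rewrite /assoc_to_be lin_ext0; apply/ffunP => t.
  rewrite ffunE fx //; apply: nondegenerate_not_be_filt1; first by rewrite size_tuple.
  exact: (valP t).
rewrite (assoc_pos a) /assoc_to_be lin_ext0; exists (fun=> 0).
by rewrite big1 // => w _; rewrite scale0r.
Qed.

Lemma surj_filt1_image r d (y : Surj R r.+1 d) :
  surj_filt 1 y <-> exists a : Assoc R r.+1 d, assoc_to_surj a = y.
Proof.
case: d y => [|d] y.
  split=> _.
    have [x <-] := table_reduction_surj y; have [a <-] := assoc_to_be_surj x.
    by exists a; rewrite table_reduction_assoc.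
  apply/surj_filtP => u /negP[]; apply: uniq_surj_filt => //.
  by rewrite uniq_ncaes basis_ncaes.
split=> [/surj_filtP fy|[a <-]].
  exists 0; rewrite /assoc_to_surj lin_ext0; apply/ffunP => t.
  rewrite ffunE fy //; apply: caesura_not_surj_filt1; first by rewrite basis_ncaes.
  exact: nondegenerate_basis.
rewrite (assoc_pos a) /assoc_to_surj lin_ext0; exists (fun=> 0).
by rewrite big1 // => w _; rewrite scale0r.
Qed.

End Associative.
Theorem mainTheorem4 (R : comPzRingType) :
  let TR : forall r d : nat, BE R r d -> Surj R r d := @table_reduction R in
  let iE : forall r d : nat, Assoc R r d -> BE R r d := @assoc_to_be R in
  let iX : forall r d : nat, Assoc R r d -> Surj R r d := @assoc_to_surj R in
  (* TR is well defined on the quotient by degenerate tuples *)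
  (forall (r d : nat) (w : d.+1.-tuple 'S_r.+1),
     TR r.+1 d (egen R d w) = table_reduction_gen R d w) /\
  (* TR is a surjective morphism of dg-operads *)
  dg_operad_morphism (O := barratt_eccles R) (P := surjection_operad R) TR /\
  (forall (r d : nat) (y : Surj R r.+1 d),
     exists x : BE R r.+1 d, TR r.+1 d x = y) /\
  (* TR preserves the filtrations *)
  (forall (n r d : nat) (x : BE R r.+1 d), (0 < n)%N ->
     be_filt n x -> surj_filt n (TR r.+1 d x)) /\
  (* the associative operad is identified with both first layers *)
  dg_operad_morphism (O := assoc_operad R) (P := barratt_eccles R) iE /\
  dg_operad_morphism (O := assoc_operad R) (P := surjection_operad R) iX /\
  (forall r d : nat, injective (iE r.+1 d) /\ injective (iX r.+1 d)) /\
  (forall (r d : nat) (x : BE R r.+1 d),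
     be_filt 1 x <-> exists a : Assoc R r.+1 d, iE r.+1 d a = x) /\
  (forall (r d : nat) (y : Surj R r.+1 d),
     surj_filt 1 y <-> exists a : Assoc R r.+1 d, iX r.+1 d a = y) /\
  (* and TR is the identity through these identifications *)
  (forall (r d : nat) (a : Assoc R r.+1 d), TR r.+1 d (iE r.+1 d a) = iX r.+1 d a).

Proof.
move=> TR iE iX; split; first by move=> r d w; apply: table_reduction_egen.
split.
  split=> [r d|r d x|r d s x||r s d e x k y] /=.
  - exact: lin_ext_linear.
  - exact: table_reduction_diff.
  - exact: table_reduction_act.
  - exact: table_reduction_unit.
  - exact: table_reduction_comp.
split; first by move=> r d y; apply: table_reduction_surj.
split; first by move=> n r d x; apply: table_reduction_filt.
split; first exact: assoc_to_be_morphism.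
split; first exact: assoc_to_surj_morphism.
split; first by move=> r d; split; [apply: assoc_to_be_inj | apply: assoc_to_surj_inj].
split; first by move=> r d x; apply: be_filt1_image.
split; first by move=> r d y; apply: surj_filt1_image.
by move=> r d a; apply: table_reduction_assoc.
Qed.
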